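(* Let $N\ge1$ be an integer. For every $s\in\mathbb{C}$ with $0<\Re(s)<1$, $$\zeta_N(s)=\frac{1}{\Gamma(s+N-1)}\int_0^\infty\left(\frac{1}{e^x-T_{N-1}(x)}-\frac{N!}{x^N}\right)x^{s+N-2}\,dx.$$
   Context: For an integer $M\ge0$, $T_M(x)=\sum_{k=0}^{M}\frac{x^k}{k!}$. For $N\ge1$, $\zeta_N(s)=\frac{1}{\Gamma(s+N-1)}\int_0^\infty \frac{x^{s+N-2}}{e^x-T_{N-1}(x)}\,dx$ for $\Re(s)>1$, and $\zeta_N$ also denotes its meromorphic continuation to $\mathbb{C}$. *)

(* Defs.v *)
From Stdlib Require Import Reals Factorial.
From Coquelicot Require Import Coquelicot.
Open Scope R_scope.

(* Coquelicot has no complex exponential. *)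
Definition Cexp (z : C) : C :=
  (exp (Re z) * cos (Im z), exp (Re z) * sin (Im z)).

(* x ^ w for a real base x > 0, with the real logarithm; junk for x <= 0. *)
Definition Rcpow (x : R) (w : C) : C := Cexp (w * ln x)%C.

(* Improper integral over (0, +oo) of a complex-valued function of a real
   variable; the lower endpoint is approached from the right, so that a
   singularity at 0 is allowed. *)
Definition converges_0_oo (f : R -> C) : Prop :=
  ex_RInt_gen (V := C_R_CompleteNormedModule) f
    (at_right 0) (Rbar_locally p_infty).

Definition integral_0_oo (f : R -> C) : C :=
  RInt_gen (V := C_R_CompleteNormedModule) f
    (at_right 0) (Rbar_locally p_infty).

(* Euler's integral, hence the Gamma function on Re z > 0 only; the arguments
   s + N - 1 with N >= 1 and Re s > 0 all lie in that half-plane. *)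
Definition Gamma (z : C) : C :=
  integral_0_oo (fun x : R => exp (- x) * Rcpow x (z - 1))%C.

Definition T (M : nat) (x : R) : R :=
  sum_f_R0 (fun k => x ^ k / INR (fact k)) M.

Definition zeta_integral (N : nat) (s : C) : C :=
  (/ Gamma (s + INR N - 1) *
   integral_0_oo (fun x : R =>
     Rcpow x (s + INR N - 2) / RtoC (exp x - T (N - 1) x)%R))%C.

Definition C_differentiable (f : C -> C) (z : C) : Prop :=
  ex_derive (K := C_AbsRing) (V := C_NormedModule) f z.

Definition holomorphic_at (f : C -> C) (z : C) : Prop :=
  locally (T := C_UniformSpace) z (C_differentiable f).

(* [locally'] is the punctured neighbourhood filter: f is holomorphic near p
   except possibly at p, and |f| tends to +oo at p. *)
Definition pole_at (f : C -> C) (p : C) : Prop :=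
  locally' (T := C_UniformSpace) p (C_differentiable f) /\
  filterlim (fun z => Cmod (f z)) (locally' (T := C_UniformSpace) p)
    (Rbar_locally p_infty).

(* Meromorphic on the whole plane.  The value of f at a pole is irrelevant;
   every other point is a point of holomorphy, so removable singularities with
   a wrong value are excluded. *)
Definition meromorphic (f : C -> C) : Prop :=
  forall z : C, holomorphic_at f z \/ pole_at f z.

(* zeta is the meromorphic continuation of zeta_N to C. It is unique up to its
   irrelevant values at the poles. *)
Definition is_hypergeometric_zeta (N : nat) (zeta : C -> C) : Prop :=
  meromorphic zeta /\
  forall s : C, 1 < Re s -> zeta s = zeta_integral N s.

(* Main.v *)
(* Let phi(x) = x^(N-1) / (e^x - T_(N-1)(x)) - N! e^-x / x, which is bounded near
   0 and decays rapidly.  For Re s > 1 the defining integral of zeta_N is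
   Mphi(s) + N! Gamma(s-1), where Mphi(s) = int phi(x) x^(s-1) dx, while for
   0 < Re s < 1 the integral of the theorem is Mphi(s) + N! Gamma(s) / (s-1),
   by an integration by parts of (e^-x - 1) x^(s-2).  Both are the function
   ((s-1) Mphi(s) + N! Gamma(s)) / (s-1), so that
     zeta(s) (s-1) Gamma(s+N-1) = (s-1) Mphi(s) + N! Gamma(s)
   on Re s > 1, and the identity must be continued to the strip, avoiding s = 1
   and excluding further poles of zeta on the way.  As differentiability is
   only pointwise, the identity theorem rests on Goursat's theorem; dividing by
   Gamma at the end requires that Gamma has no zero in Re z > 0. *)

Require Import Defs.
From Stdlib Require Import Reals Factorial Lra Lia Psatz Classical ClassicalEpsilon.
From Coquelicot Require Import Coquelicot.
Open Scope R_scope.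

(** * Continuity and differentiability of complex-valued functions *)

(** Estimates are made in the variable ln x: a bound x |f(x)| <= K e^(-al |ln x|) gives convergence
    at 0 and at infinity at once, with an explicit bound on the integral, and a factor ln x or x^h
    with h small costs only part of al. Mellin transforms can therefore be differentiated by
    bounding a second-order remainder. The identity theorem uses neither Cauchy's formula nor power
    series: the value at a point is extracted from Goursat's theorem by a concentrating kernel, so
    nothing beyond pointwise differentiability has to be established. Continuation runs along one
    segment that misses s = 1, the only zero of (s-1) Gamma(s+N-1) in Re s > 0. Where this factor is
    nonzero a pole is impossible, because zeta would be a bounded quotient at points arbitrarily
    close to it; at s = 1 the argument breaks down. Nonvanishing of Gamma is thus used twice, along
    the segment and in the final division; it comes from a variance estimate. *)

Lemma norm_C_R (z : C) : norm (V := C_R_NormedModule) z = Cmod z.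
Proof. rewrite Cmod_norm; reflexivity. Qed.

Lemma locally_C_iff (z : C) (P : C -> Prop) :
  locally (T := C_UniformSpace) z P <->
  exists d : R, 0 < d /\ forall w : C, Cmod (w - z) < d -> P w.
Proof.
rewrite locally_C; split.
- intros [d Hd]; exists d; split; [apply cond_pos | intros w Hw; apply Hd, Hw].
- intros [d [Hd H]]; exists (mkposreal d Hd); intros w Hw; apply H, Hw.
Qed.

(** The codomain is [C] as a module over itself, the form to which the product and chain rules
    apply. It differs from [C_differentiable] only in this module structure; [C_differentiable_iff]
    reconciles the two. *)
Definition is_Cderive (f : C -> C) (z l : C) : Prop :=
  is_derive (K := C_AbsRing) (V := AbsRing_NormedModule C_AbsRing) f z l.

Lemma is_Cderive_iff (f : C -> C) (z l : C) :
  is_Cderive f z l <->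
  forall e : R, 0 < e -> exists d : R, 0 < d /\
    forall w : C, Cmod (w - z) < d ->
      Cmod (f w - f z - (w - z) * l) <= e * Cmod (w - z).
Proof.
split.
- intros [_ H] e He.
  destruct (H z (fun P HP => HP) (mkposreal e He)) as [d Hd].
  exists d; split; [apply cond_pos | intros w Hw; apply (Hd w Hw)].
- intros H; split.
  + apply is_linear_scal_l.
  + intros x Hx e.
    rewrite <- (is_filter_lim_locally_unique _ _ Hx).
    destruct (H e (cond_pos e)) as [d [Hd Hd']].
    exists (mkposreal d Hd); intros w Hw; apply Hd', Hw.
Qed.

Lemma C_differentiable_iff (f : C -> C) (z : C) :
  C_differentiable f z <-> exists l : C, is_Cderive f z l.
Proof.
split; intros [l [_ H]]; exists l; split; try apply is_linear_scal_l; exact H.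
Qed.

Lemma Rlocally_iff (x : R) (P : R -> Prop) :
  locally (T := R_UniformSpace) x P <->
  exists d : R, 0 < d /\ forall y : R, Rabs (y - x) < d -> P y.
Proof.
split.
- intros [d Hd]; exists d; split; [apply cond_pos | intros y Hy; apply Hd, Hy].
- intros [d [Hd H]]; exists (mkposreal d Hd); intros y Hy; apply H, Hy.
Qed.

Definition RC_continuous (f : R -> C) (x : R) : Prop :=
  continuous (T := R_UniformSpace) (U := C_UniformSpace) f x.

Definition CC_continuous (f : C -> C) (z : C) : Prop :=
  continuous (T := C_UniformSpace) (U := C_UniformSpace) f z.

Lemma filterlim_C_iff {T : Type} (F : (T -> Prop) -> Prop) {FF : Filter F}
    (f : T -> C) (l : C) :
  filterlim f F (locally (T := C_UniformSpace) l) <->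
  forall e : R, 0 < e -> F (fun t => Cmod (f t - l) < e).
Proof.
split.
- intros H e He; apply (H (fun w => Cmod (w - l) < e)), locally_C_iff; exists e; auto.
- intros H P HP; apply locally_C_iff in HP; destruct HP as [d [Hd HP]].
  unfold filtermap.
  generalize (H d Hd); apply filter_imp; auto.
Qed.

Lemma RC_continuous_iff (f : R -> C) (x : R) :
  RC_continuous f x <->
  forall e : R, 0 < e -> exists d : R, 0 < d /\
    forall y : R, Rabs (y - x) < d -> Cmod (f y - f x) < e.
Proof.
unfold RC_continuous, continuous.
rewrite (filterlim_C_iff (locally (T := R_UniformSpace) x)).
split; intros H e He; apply Rlocally_iff, H, He.
Qed.

Lemma CC_continuous_iff (f : C -> C) (z : C) :
  CC_continuous f z <->
  forall e : R, 0 < e -> exists d : R, 0 < d /\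
    forall w : C, Cmod (w - z) < d -> Cmod (f w - f z) < e.
Proof.
unfold CC_continuous, continuous.
rewrite (filterlim_C_iff (locally (T := C_UniformSpace) z)).
split; intros H e He; apply locally_C_iff, H, He.
Qed.

Lemma filterlim_C_Re (z : C) :
  filterlim Re (locally (T := C_UniformSpace) z) (locally (Re z)).
Proof. apply (continuous_fst (U := R_UniformSpace) (V := R_UniformSpace)). Qed.

Lemma filterlim_C_Im (z : C) :
  filterlim Im (locally (T := C_UniformSpace) z) (locally (Im z)).
Proof. apply (continuous_snd (U := R_UniformSpace) (V := R_UniformSpace)). Qed.

Lemma Cmod_le_abs (z : C) : Cmod z <= Rabs (Re z) + Rabs (Im z).
Proof.
unfold Cmod.
apply Rsqr_incr_0_var.
- rewrite Rsqr_sqrt by nra.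
  unfold Re, Im, Rsqr.
  pose proof (pow2_abs (fst z)); pose proof (pow2_abs (snd z)).
  pose proof (Rabs_pos (fst z)); pose proof (Rabs_pos (snd z)); nra.
- pose proof (Rabs_pos (Re z)); pose proof (Rabs_pos (Im z)); lra.
Qed.

Lemma im_le_Cmod (z : C) : Rabs (Im z) <= Cmod z.
Proof.
apply Rle_trans with (2 := Rmax_Cmod z); apply Rmax_r.
Qed.

Lemma RC_continuous_pair (f : R -> C) (x : R) :
  continuous (fun t => Re (f t)) x -> continuous (fun t => Im (f t)) x ->
  RC_continuous f x.
Proof.
intros H1 H2; apply RC_continuous_iff; intros e He.
assert (He2 : 0 < e / 2) by lra.
assert (K1 : locally x (fun t => Rabs (Re (f t) - Re (f x)) < e / 2)).
{ apply (H1 (fun u => Rabs (u - Re (f x)) < e / 2)), Rlocally_iff.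
  exists (e / 2); auto. }
assert (K2 : locally x (fun t => Rabs (Im (f t) - Im (f x)) < e / 2)).
{ apply (H2 (fun u => Rabs (u - Im (f x)) < e / 2)), Rlocally_iff.
  exists (e / 2); auto. }
generalize (filter_and _ _ K1 K2); intros K; apply Rlocally_iff in K.
destruct K as [d [Hd K]]; exists d; split; auto; intros y Hy.
destruct (K y Hy) as [A B].
apply Rle_lt_trans with (1 := Cmod_le_abs _).
unfold Re, Im in *; simpl in *; unfold Rminus in *; lra.
Qed.

Lemma RC_continuous_Re (f : R -> C) (x : R) :
  RC_continuous f x -> continuous (fun t => Re (f t)) x.
Proof. intros H; apply filterlim_comp with (1 := H), filterlim_C_Re. Qed.

Lemma RC_continuous_Im (f : R -> C) (x : R) :
  RC_continuous f x -> continuous (fun t => Im (f t)) x.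
Proof. intros H; apply filterlim_comp with (1 := H), filterlim_C_Im. Qed.

Lemma RC_continuous_plus (f g : R -> C) (x : R) :
  RC_continuous f x -> RC_continuous g x ->
  RC_continuous (fun t => f t + g t)%C x.
Proof. apply (continuous_plus (V := C_R_NormedModule)). Qed.

Lemma RC_continuous_minus (f g : R -> C) (x : R) :
  RC_continuous f x -> RC_continuous g x ->
  RC_continuous (fun t => f t - g t)%C x.
Proof. apply (continuous_minus (V := C_R_NormedModule)). Qed.

Lemma RC_continuous_mult (f g : R -> C) (x : R) :
  RC_continuous f x -> RC_continuous g x ->
  RC_continuous (fun t => f t * g t)%C x.
Proof.
intros Hf Hg.
pose proof (RC_continuous_Re _ _ Hf); pose proof (RC_continuous_Im _ _ Hf).
pose proof (RC_continuous_Re _ _ Hg); pose proof (RC_continuous_Im _ _ Hg).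
apply RC_continuous_pair.
- apply (continuous_minus (V := R_NormedModule));
    apply (continuous_mult (K := R_AbsRing)); assumption.
- apply (continuous_plus (V := R_NormedModule));
    apply (continuous_mult (K := R_AbsRing)); assumption.
Qed.

Lemma RC_continuous_RtoC (f : R -> R) (x : R) :
  continuous f x -> RC_continuous (fun t => RtoC (f t)) x.
Proof.
intros H; apply RC_continuous_pair; [exact H | apply continuous_const].
Qed.

Lemma RC_continuous_const (c : C) (x : R) : RC_continuous (fun _ => c) x.
Proof. apply continuous_const. Qed.

Lemma Cmod_triangle_inv (z w : C) : Rabs (Cmod z - Cmod w) <= Cmod (z - w).
Proof.
pose proof (Cmod_triangle (z - w) w) as H1.
pose proof (Cmod_triangle (w - z) z) as H2.
replace (z - w + w)%C with z in H1 by ring.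
replace (w - z + z)%C with w in H2 by ring.
replace (Cmod (w - z)) with (Cmod (z - w)) in H2
  by (rewrite <- Cmod_opp; f_equal; ring).
apply Rabs_le; lra.
Qed.

Lemma continuous_Cmod (f : R -> C) (x : R) :
  RC_continuous f x -> continuous (fun t => Cmod (f t)) x.
Proof.
intros H P HP; apply Rlocally_iff in HP; destruct HP as [d [Hd HP]].
unfold filtermap; apply Rlocally_iff.
destruct (proj1 (RC_continuous_iff f x) H d Hd) as [e [He K]].
exists e; split; auto; intros y Hy; apply HP.
apply Rle_lt_trans with (2 := K y Hy).
apply Cmod_triangle_inv.
Qed.

Lemma is_Cderive_continuous (f : C -> C) (z l : C) :
  is_Cderive f z l -> CC_continuous f z.
Proof.
intros H; apply CC_continuous_iff; intros e He.
destruct (proj1 (is_Cderive_iff f z l) H 1 Rlt_0_1) as [d [Hd K]].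
assert (Hl := Cmod_ge_0 l).
exists (Rmin d (e / (1 + Cmod l))); split.
- apply Rmin_pos; auto; apply Rdiv_lt_0_compat; lra.
- intros w Hw.
  assert (Hw1 := Rlt_le_trans _ _ _ Hw (Rmin_l _ _)).
  assert (Hw2 := Rlt_le_trans _ _ _ Hw (Rmin_r _ _)).
  replace (f w - f z)%C with ((f w - f z - (w - z) * l) + (w - z) * l)%C by ring.
  apply Rle_lt_trans with (1 := Cmod_triangle _ _).
  rewrite Cmod_mult.
  apply Rle_lt_trans with (1 * Cmod (w - z) + Cmod (w - z) * Cmod l).
  + apply Rplus_le_compat_r, K, Hw1.
  + apply (Rmult_lt_compat_r (1 + Cmod l)) in Hw2; [|lra].
    unfold Rdiv in Hw2; rewrite Rmult_assoc, Rinv_l in Hw2 by lra; lra.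
Qed.

Definition is_RCderive (f : R -> C) (x : R) (l : C) : Prop :=
  is_derive (K := R_AbsRing) (V := C_R_NormedModule) f x l.

Lemma is_RCderive_pair (f : R -> C) (x : R) (l : C) :
  is_derive (fun t => Re (f t)) x (Re l) ->
  is_derive (fun t => Im (f t)) x (Im l) -> is_RCderive f x l.
Proof.
intros [_ H1] [_ H2]; split; [apply is_linear_scal_l|].
intros y Hy; rewrite <- (is_filter_lim_locally_unique _ _ Hy); intros e.
assert (He : 0 < e / 2) by (pose proof (cond_pos e); lra).
generalize (filter_and _ _ (H1 x (fun P HP => HP) (mkposreal _ He))
  (H2 x (fun P HP => HP) (mkposreal _ He))).
apply filter_imp; intros t [A B].
rewrite norm_C_R.
apply Rle_trans with (1 := Cmod_le_abs _).
unfold norm in *; simpl in *; unfold abs, minus, plus, opp, scal in *; simpl in *.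
unfold prod_plus, prod_scal, scal in *; simpl in *; unfold mult, Re, Im in *; simpl in *.
lra.
Qed.

(** * The complex exponential *)

Lemma is_Cderive_const (c z : C) : is_Cderive (fun _ => c) z 0.
Proof.
exact (is_derive_const (V := AbsRing_NormedModule C_AbsRing) c z).
Qed.

Lemma is_Cderive_id (z : C) : is_Cderive (fun w => w) z 1.
Proof. apply (is_derive_id (K := C_AbsRing)). Qed.

Lemma is_Cderive_plus (f g : C -> C) (z k l : C) :
  is_Cderive f z k -> is_Cderive g z l ->
  is_Cderive (fun w => f w + g w)%C z (k + l).
Proof.
exact (is_derive_plus (V := AbsRing_NormedModule C_AbsRing) f g z k l).
Qed.

Lemma is_Cderive_minus (f g : C -> C) (z k l : C) :
  is_Cderive f z k -> is_Cderive g z l ->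
  is_Cderive (fun w => f w - g w)%C z (k - l).
Proof.
exact (is_derive_minus (V := AbsRing_NormedModule C_AbsRing) f g z k l).
Qed.

Lemma is_Cderive_mult (f g : C -> C) (z k l : C) :
  is_Cderive f z k -> is_Cderive g z l ->
  is_Cderive (fun w => f w * g w)%C z (k * g z + f z * l).
Proof.
intros Hf Hg.
exact (is_derive_mult (K := C_AbsRing) f g z k l Hf Hg Cmult_comm).
Qed.

Lemma is_Cderive_comp (f g : C -> C) (z k l : C) :
  is_Cderive f (g z) k -> is_Cderive g z l ->
  is_Cderive (fun w => f (g w)) z (l * k).
Proof.
exact (is_derive_comp (V := AbsRing_NormedModule C_AbsRing) f g z k l).
Qed.

Lemma C_eq (z w : C) : Re z = Re w -> Im z = Im w -> z = w.
Proof. destruct z, w; simpl; intros -> ->; reflexivity. Qed.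

Lemma re_minus (a b : C) : Re (a - b) = Re a - Re b.
Proof. reflexivity. Qed.

Lemma Cexp_0 : Cexp 0 = 1.
Proof.
apply C_eq; simpl; rewrite exp_0; [rewrite cos_0 | rewrite sin_0]; ring.
Qed.

Lemma Cexp_plus (z w : C) : Cexp (z + w) = (Cexp z * Cexp w)%C.
Proof.
unfold Cexp, Cmult; simpl; unfold Re, Im.
rewrite exp_plus, cos_plus, sin_plus; apply C_eq; simpl; ring.
Qed.

Lemma Cmod_Cexp (z : C) : Cmod (Cexp z) = exp (Re z).
Proof.
unfold Cmod, Cexp; simpl.
pose proof (sin2_cos2 (Im z)) as H; unfold Rsqr in H.
transitivity (sqrt (exp (Re z) * exp (Re z)));
  [f_equal | apply sqrt_square; left; apply exp_pos].
transitivity (exp (Re z) * exp (Re z) *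
  (sin (Im z) * sin (Im z) + cos (Im z) * cos (Im z))); [ring | rewrite H; ring].
Qed.

Lemma Cexp_RtoC (x : R) : Cexp x = exp x.
Proof.
apply C_eq; simpl; [rewrite cos_0 | rewrite sin_0]; ring.
Qed.

Lemma is_RCderive_Cexp_line (z : C) (t : R) :
  is_RCderive (fun t => Cexp (t * z)) t (z * Cexp (t * z)).
Proof.
apply is_RCderive_pair; simpl; unfold Re, Im; simpl; auto_derive; auto; unfold Rminus; ring.
Qed.

Lemma RC_continuous_is_RCderive (f : R -> C) (x : R) (l : C) :
  is_RCderive f x l -> RC_continuous f x.
Proof.
intros H.
apply (ex_derive_continuous (K := R_AbsRing) (V := C_R_NormedModule)).
exists l; exact H.
Qed.

(** Substitute for the mean value theorem, which fails for complex values: a bound on the derivative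
    is integrated. A varying majorant [dh], not just a constant, is what [Cexp_real_increment]
    requires. *)
Lemma RC_increment_bound (f df : R -> C) (h dh : R -> R) (a b : R) :
  a <= b ->
  (forall x, a <= x <= b -> is_RCderive f x (df x)) ->
  (forall x, a <= x <= b -> RC_continuous df x) ->
  (forall x, a <= x <= b -> is_derive h x (dh x)) ->
  (forall x, a <= x <= b -> continuous dh x) ->
  (forall x, a <= x <= b -> Cmod (df x) <= dh x) ->
  Cmod (f b - f a) <= h b - h a.
Proof.
intros Hab H1 H2 H3 H4 H5.
change (Cmod (f b - f a)) with (Cmod (minus (G := C_R_NormedModule) (f b) (f a))).
rewrite <- norm_C_R.
apply (norm_RInt_le (V := C_R_NormedModule) df dh a b); auto.
- intros x Hx; rewrite norm_C_R; auto.
- apply (is_RInt_derive (V := C_R_CompleteNormedModule));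
    rewrite Rmin_left, Rmax_right by assumption; assumption.
- apply (is_RInt_derive (V := R_CompleteNormedModule));
    rewrite Rmin_left, Rmax_right by assumption; assumption.
Qed.

Lemma Cexp_minus_1_le (z : C) : Cmod (Cexp z - 1) <= Cmod z * exp (Cmod z).
Proof.
replace (Cexp z - 1)%C with (Cexp (1%R * z) - Cexp (0%R * z))%C.
2:{ replace (1%R * z)%C with z by (simpl; ring).
    replace (0%R * z)%C with (RtoC 0) by (simpl; ring).
    rewrite Cexp_0; reflexivity. }
replace (Cmod z * exp (Cmod z))
  with (1 * (Cmod z * exp (Cmod z)) - 0 * (Cmod z * exp (Cmod z))) by ring.
apply (RC_increment_bound (fun t => Cexp (t * z)) (fun t => z * Cexp (t * z))%C
  (fun t => t * (Cmod z * exp (Cmod z))) (fun _ => Cmod z * exp (Cmod z)));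
  try lra; intros t Ht.
- apply is_RCderive_Cexp_line.
- apply RC_continuous_mult; [apply RC_continuous_const|].
  eapply RC_continuous_is_RCderive, is_RCderive_Cexp_line.
- auto_derive; auto; ring.
- apply continuous_const.
- rewrite Cmod_mult, Cmod_Cexp, re_scal_l.
  apply Rmult_le_compat_l; [apply Cmod_ge_0|].
  pose proof (re_le_Cmod z) as H; apply Rabs_le_between in H.
  pose proof (Cmod_ge_0 z).
  assert (t * Re z <= Cmod z) by nra.
  destruct (Req_dec (t * Re z) (Cmod z)) as [->|]; [right; auto|].
  left; apply exp_increasing; lra.
Qed.

Lemma exp_le (x y : R) : x <= y -> exp x <= exp y.
Proof.
intros [H| ->]; [left; apply exp_increasing, H | right; reflexivity].
Qed.

Lemma Cexp_taylor1 (z : C) :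
  Cmod (Cexp z - 1 - z) <= Cmod z ^ 2 * exp (Cmod z).
Proof.
set (f := fun t : R => (Cexp (t * z) - 1 - t * z)%C).
replace (Cexp z - 1 - z)%C with (f 1 - f 0)%C.
2:{ unfold f; replace (1%R * z)%C with z by (simpl; ring).
    replace (0%R * z)%C with (RtoC 0) by (simpl; ring).
    rewrite Cexp_0; simpl; ring. }
set (c := Cmod z ^ 2 * exp (Cmod z)).
replace c with (1 * c - 0 * c) by ring.
assert (Hd : forall t, is_RCderive f t (z * (Cexp (t * z) - 1))).
{ intros t; apply is_RCderive_pair; unfold f; simpl; unfold Re, Im; simpl;
    auto_derive; auto; unfold Rminus; ring. }
apply (RC_increment_bound f (fun t => z * (Cexp (t * z) - 1))%C
  (fun t => t * c) (fun _ => c)); try lra; intros t Ht.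
- apply Hd.
- apply RC_continuous_mult; [apply RC_continuous_const|].
  apply RC_continuous_minus; [|apply RC_continuous_const].
  eapply RC_continuous_is_RCderive, is_RCderive_Cexp_line.
- auto_derive; auto; ring.
- apply continuous_const.
- rewrite Cmod_mult.
  pose proof (Cmod_ge_0 z).
  replace c with (Cmod z * (Cmod z * exp (Cmod z))) by (unfold c; ring).
  apply Rmult_le_compat_l; auto.
  apply Rle_trans with (1 := Cexp_minus_1_le _).
  rewrite Cmod_mult, Cmod_R, Rabs_pos_eq by lra.
  apply Rmult_le_compat; try nra; [left; apply exp_pos | apply exp_le; nra].
Qed.

Lemma is_Cderive_Cexp (z : C) : is_Cderive Cexp z (Cexp z).
Proof.
apply is_Cderive_iff; intros e He.
set (m := exp (Re z) * exp 1).
assert (Hm : 0 < m) by (apply Rmult_lt_0_compat; apply exp_pos).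
exists (Rmin 1 (e / m)); split.
- apply Rmin_pos; [lra | apply Rdiv_lt_0_compat; auto].
- intros w Hw.
  assert (Hw1 := Rlt_le_trans _ _ _ Hw (Rmin_l _ _)).
  assert (Hw2 := Rlt_le_trans _ _ _ Hw (Rmin_r _ _)).
  set (h := (w - z)%C) in *.
  replace w with (z + h)%C by (unfold h; ring).
  rewrite Cexp_plus.
  replace (Cexp z * Cexp h - Cexp z - h * Cexp z)%C
    with (Cexp z * (Cexp h - 1 - h))%C by ring.
  rewrite Cmod_mult, Cmod_Cexp.
  pose proof (Cmod_ge_0 h); pose proof (exp_pos (Re z)).
  apply Rle_trans with (exp (Re z) * (Cmod h ^ 2 * exp 1)).
  + apply Rmult_le_compat_l; [lra|].
    apply Rle_trans with (1 := Cexp_taylor1 h).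
    apply Rmult_le_compat_l; [nra | apply exp_le; lra].
  + apply (Rmult_lt_compat_r m) in Hw2; auto.
    unfold Rdiv in Hw2; rewrite Rmult_assoc, Rinv_l in Hw2 by lra.
    unfold m in *; nra.
Qed.

(** The derivative of e^(t w) has modulus |w| e^(t Re w), which is |w| / Re w times the derivative
    of the real function e^(t Re w). With L = ln t this compares t^w - 1 with t^(Re w) - 1. *)
Lemma Cexp_real_increment (w : C) (L : R) :
  0 < Re w ->
  Cmod (Cexp (L * w) - 1) <= Cmod w / Re w * Rabs (exp (L * Re w) - 1).
Proof.
intros Hw.
set (h := fun t => Cmod w / Re w * exp (t * Re w)).
set (f := fun t : R => Cexp (t * w)).
assert (H : forall a b, a <= b -> Cmod (f b - f a) <= h b - h a).
{ intros a b Hab.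
  apply (RC_increment_bound f (fun t => w * Cexp (t * w))%C
    h (fun t => Cmod w * exp (t * Re w))); auto; intros t _.
  - apply is_RCderive_Cexp_line.
  - apply RC_continuous_mult; [apply RC_continuous_const|].
    eapply RC_continuous_is_RCderive, is_RCderive_Cexp_line.
  - unfold h; auto_derive; auto; field; lra.
  - apply (ex_derive_continuous (K := R_AbsRing) (V := R_NormedModule)).
    auto_derive; auto.
  - rewrite Cmod_mult, Cmod_Cexp, re_scal_l; right; reflexivity. }
assert (H0 : f 0 = 1).
{ unfold f; rewrite <- Cexp_0; f_equal; ring. }
assert (Hh0 : h 0 = Cmod w / Re w).
{ unfold h; rewrite Rmult_0_l, exp_0; ring. }
assert (Hc : 0 <= Cmod w / Re w).
{ apply Rle_mult_inv_pos; auto; apply Cmod_ge_0. }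
rewrite <- H0; fold (f L).
destruct (Rle_dec 0 L) as [HL|HL].
- apply Rle_trans with (1 := H 0 L HL).
  rewrite Hh0; unfold h.
  pose proof (Rle_abs (exp (L * Re w) - 1)); nra.
- apply Rnot_le_lt, Rlt_le in HL.
  replace (f L - f 0)%C with (- (f 0 - f L))%C by ring; rewrite Cmod_opp.
  apply Rle_trans with (1 := H L 0 HL).
  rewrite Hh0; unfold h.
  pose proof (Rle_abs (- (exp (L * Re w) - 1))) as K; rewrite Rabs_Ropp in K; nra.
Qed.

(** * Improper integrals over (0, +oo) *)

Definition RCInt (f : R -> C) (a b : R) : C :=
  RInt (V := C_R_CompleteNormedModule) f a b.

Definition is_integral_0_oo (f : R -> C) (l : C) : Prop :=
  is_RInt_gen (V := C_R_NormedModule) f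
    (at_right 0) (Rbar_locally p_infty) l.

Lemma is_integral_0_oo_unique (f : R -> C) (l : C) :
  is_integral_0_oo f l -> integral_0_oo f = l.
Proof.
exact (is_RInt_gen_unique (V := C_R_CompleteNormedModule) f l).
Qed.

Lemma at_right_0_exp_ln (al e : R) :
  0 < al -> 0 < e -> at_right 0 (fun x => exp (- al * Rabs (ln x)) < e).
Proof.
intros Hal He; apply Rlocally_iff.
exists (Rmin 1 (exp (ln e / al))); split.
- apply Rmin_pos; [lra | apply exp_pos].
- intros x Hx Hx0; rewrite Rminus_0_r, Rabs_pos_eq in Hx by lra.
  assert (Hx1 := Rlt_le_trans _ _ _ Hx (Rmin_l _ _)).
  assert (Hx2 := Rlt_le_trans _ _ _ Hx (Rmin_r _ _)).
  apply ln_increasing in Hx1; auto; rewrite ln_1 in Hx1.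
  apply ln_increasing in Hx2; auto; rewrite ln_exp in Hx2.
  rewrite Rabs_left by lra.
  rewrite <- (exp_ln e) by auto; apply exp_increasing.
  apply (Rmult_lt_compat_r al) in Hx2; auto.
  unfold Rdiv in Hx2; rewrite Rmult_assoc, Rinv_l in Hx2 by lra; lra.
Qed.

Lemma p_infty_exp_ln (al e : R) :
  0 < al -> 0 < e ->
  Rbar_locally p_infty (fun x => exp (- al * Rabs (ln x)) < e).
Proof.
intros Hal He.
exists (Rmax 1 (exp (- ln e / al))); intros x Hx.
assert (Hx1 := Rle_lt_trans _ _ _ (Rmax_l _ _) Hx).
assert (Hx2 := Rle_lt_trans _ _ _ (Rmax_r _ _) Hx).
apply ln_increasing in Hx1; [|lra]; rewrite ln_1 in Hx1.
apply ln_increasing in Hx2; [|apply exp_pos]; rewrite ln_exp in Hx2.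
rewrite Rabs_pos_eq by lra.
rewrite <- (exp_ln e) by auto; apply exp_increasing.
apply (Rmult_lt_compat_r al) in Hx2; auto.
unfold Rdiv in Hx2; rewrite Rmult_assoc, Rinv_l in Hx2 by lra; lra.
Qed.

Lemma at_right_pos : at_right 0 (fun x => 0 < x).
Proof. apply Rlocally_iff; exists 1; split; [lra | auto]. Qed.

Lemma p_infty_gt (M : R) : Rbar_locally p_infty (fun x => M < x).
Proof. exists M; auto. Qed.

Lemma at_right_lt_1 : at_right 0 (fun x => x < 1).
Proof.
apply Rlocally_iff; exists 1; split; [lra|]; intros y Hy _.
rewrite Rminus_0_r in Hy; apply Rabs_lt_between in Hy; lra.
Qed.

Lemma filter_prod_of (F G : (R -> Prop) -> Prop) (P Q : R -> Prop)
    (S : R * R -> Prop) :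
  F P -> G Q -> (forall a b, P a -> Q b -> S (a, b)) -> filter_prod F G S.
Proof. intros HP HQ H; exists P Q; assumption. Qed.

Lemma pos_between (a b x : R) :
  0 < a -> 0 < b -> Rmin a b <= x <= Rmax a b -> 0 < x.
Proof.
intros Ha Hb [Hx _]; apply Rlt_le_trans with (2 := Hx); apply Rmin_pos; auto.
Qed.

Lemma is_RCInt (f : R -> C) (a b : R) :
  (forall x, Rmin a b <= x <= Rmax a b -> RC_continuous f x) ->
  is_RInt (V := C_R_NormedModule) f a b (RCInt f a b).
Proof.
intros H; apply (RInt_correct (V := C_R_CompleteNormedModule)).
apply (ex_RInt_continuous (V := C_R_CompleteNormedModule)); exact H.
Qed.

Section Domination.

Variables (f : R -> C) (al K : R).
Hypothesis Hf : forall x, 0 < x -> RC_continuous f x.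
Hypothesis Hal : 0 < al.
Hypothesis HK :
  forall x, 0 < x -> x * Cmod (f x) <= K * exp (- al * Rabs (ln x)).

(** With u = x^al, [Q] is a primitive of u / (x (1+u)^2), which is comparable to e^(-al |ln x|) / x
    on all of (0, +oo). It rises from -1/al at 0 to 0 at infinity, so a single bounded primitive
    controls both ends and the integral need not be split at 1. *)
Let Q x := - / al / (1 + exp (al * ln x)).

Lemma domination_K_pos : 0 <= K.
Proof.
specialize (HK 1 Rlt_0_1); rewrite ln_1, Rabs_R0, Rmult_0_r, exp_0 in HK.
pose proof (Cmod_ge_0 (f 1)); lra.
Qed.

Lemma domination_RInt_le (a b : R) :
  0 < a -> a <= b -> Cmod (RCInt f a b) <= 4 * K * (Q b - Q a).
Proof.
intros Ha Hab.
set (D x := exp (al * ln x) / x / (1 + exp (al * ln x)) ^ 2).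
rewrite <- norm_C_R.
apply (norm_RInt_le (V := C_R_NormedModule) f (fun x => 4 * K * D x) a b); auto.
- intros x Hx; rewrite norm_C_R.
  assert (Hx0 : 0 < x) by lra.
  pose proof (HK x Hx0) as HKx.
  set (u := exp (al * ln x)) in *.
  assert (Hu : 0 < u) by apply exp_pos.
  assert (HD : x * D x = u / (1 + u) ^ 2).
  { unfold D; fold u; field; lra. }
  (* The left side is min(u, 1/u), and 1 + u <= 2 max(1, u); this is the origin of the 4. *)
  assert (HE : exp (- al * Rabs (ln x)) <= 4 * (u / (1 + u) ^ 2)).
  { apply Rmult_le_reg_r with ((1 + u) ^ 2); [nra|].
    replace (4 * (u / (1 + u) ^ 2) * (1 + u) ^ 2) with (4 * u) by (field; lra).
    destruct (Rle_dec 0 (ln x)) as [HL|HL].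
    - rewrite Rabs_pos_eq by auto.
      replace (- al * ln x) with (- (al * ln x)) by ring.
      rewrite exp_Ropp; fold u.
      assert (1 <= u).
      { unfold u; rewrite <- exp_0; apply exp_le; nra. }
      apply Rmult_le_reg_l with u; auto.
      rewrite <- Rmult_assoc, Rinv_r by lra; nra.
    - apply Rnot_le_lt in HL; rewrite Rabs_left by auto.
      replace (- al * - ln x) with (al * ln x) by ring; fold u.
      assert (u <= 1).
      { unfold u; rewrite <- exp_0; apply exp_le; nra. }
      nra. }
  apply Rmult_le_reg_l with x; auto.
  apply Rle_trans with (1 := HKx).
  replace (x * (4 * K * D x)) with (K * (4 * (x * D x))) by ring.
  rewrite HD; apply Rmult_le_compat_l; auto; apply domination_K_pos.
- apply is_RCInt; intros x Hx; apply Hf, (pos_between a b); lra.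
- apply (is_RInt_scal (V := R_NormedModule) D).
  apply (is_RInt_derive (V := R_CompleteNormedModule));
    intros x Hx; apply pos_between in Hx; try lra;
    pose proof (exp_pos (al * ln x)).
  + unfold Q, D; auto_derive; [repeat split; lra|].
    field; repeat split; lra.
  + apply (ex_derive_continuous (K := R_AbsRing) (V := R_NormedModule)).
    unfold D; auto_derive; repeat split; try lra.
    pose proof (pow_lt (1 + exp (al * ln x)) 2); lra.
Qed.

(** The Cauchy criterion compares two endpoints whose order is unknown. *)
Lemma domination_RInt_le_abs (a b : R) :
  0 < a -> 0 < b -> Cmod (RCInt f a b) <= 4 * K * Rabs (Q b - Q a).
Proof.
intros Ha Hb; pose proof domination_K_pos.
destruct (Rle_dec a b) as [Hab|Hab].
- apply Rle_trans with (1 := domination_RInt_le a b Ha Hab).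
  apply Rmult_le_compat_l; [lra | apply Rle_abs].
- assert (Hba : b <= a) by lra.
  assert (HI := is_RInt_swap (V := C_R_NormedModule) _ _ _ _
    (is_RCInt f b a (fun x Hx => Hf x (pos_between b a x Hb Ha Hx)))).
  apply (is_RInt_unique (V := C_R_CompleteNormedModule)) in HI.
  unfold RCInt at 1; rewrite HI.
  change (opp (G := C_R_NormedModule) (RCInt f b a)) with (- RCInt f b a)%C.
  rewrite Cmod_opp.
  apply Rle_trans with (1 := domination_RInt_le b a Hb Hba).
  apply Rmult_le_compat_l; [lra|].
  rewrite Rabs_minus_sym; apply Rle_abs.
Qed.

Lemma RCInt_Chasles (a b c : R) :
  0 < a -> 0 < b -> 0 < c -> (RCInt f a b + RCInt f b c)%C = RCInt f a c.
Proof.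
intros Ha Hb Hc; apply (RInt_Chasles (V := C_R_CompleteNormedModule));
  apply (ex_RInt_continuous (V := C_R_CompleteNormedModule));
  intros x Hx; apply Hf; eapply pos_between; [| |exact Hx| | |exact Hx]; auto.
Qed.

Lemma domination_Q_bounds (x : R) :
  0 < x -> 
  0 <= Q x + / al <= / al * exp (al * ln x) /\
  - / al * exp (- (al * ln x)) <= Q x <= 0.
Proof.
intros Hx; unfold Q; rewrite exp_Ropp.
set (u := exp (al * ln x)).
assert (Hu : 0 < u) by apply exp_pos.
assert (Hi : 0 < / al) by (apply Rinv_0_lt_compat; auto).
assert (H1 : 0 < / (1 + u)) by (apply Rinv_0_lt_compat; lra).
assert (H2 : / (1 + u) <= 1).
{ rewrite <- Rinv_1; apply Rinv_le_contravar; lra. }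
assert (H3 : / (1 + u) <= / u) by (apply Rinv_le_contravar; lra).
replace (- / al / (1 + u) + / al) with (/ al * (u * / (1 + u))) by (field; lra).
replace (- / al / (1 + u)) with (- (/ al * / (1 + u))) by (field; lra).
repeat split.
- apply Rmult_le_pos; [lra|]; apply Rmult_le_pos; lra.
- apply Rmult_le_compat_l; [lra|].
  rewrite <- (Rmult_1_r u) at 3; apply Rmult_le_compat_l; lra.
- rewrite Ropp_mult_distr_l_reverse.
  apply Ropp_le_contravar, Rmult_le_compat_l; lra.
- assert (0 < / al * / (1 + u)) by (apply Rmult_lt_0_compat; auto); lra.
Qed.

Lemma at_right_0_Q (e : R) :
  0 < e -> at_right 0 (fun x => 0 < x /\ Rabs (Q x + / al) < e).
Proof.
intros He; assert (Hea : 0 < e * al) by (apply Rmult_lt_0_compat; auto).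
generalize (filter_and _ _ at_right_pos (filter_and _ _ at_right_lt_1
  (at_right_0_exp_ln al (e * al) Hal Hea))).
apply filter_imp; intros x (Hx & Hx1 & H); split; auto.
destruct (domination_Q_bounds x Hx) as [[A B] _].
rewrite Rabs_pos_eq by auto.
apply Rle_lt_trans with (1 := B).
apply ln_increasing in Hx1; auto; rewrite ln_1 in Hx1.
rewrite Rabs_left in H by auto.
replace (- al * - ln x) with (al * ln x) in H by ring.
apply Rmult_lt_reg_l with al; auto; rewrite <- Rmult_assoc, Rinv_r; lra.
Qed.

Lemma p_infty_Q (e : R) :
  0 < e -> Rbar_locally p_infty (fun x => 0 < x /\ Rabs (Q x) < e).
Proof.
intros He; assert (Hea : 0 < e * al) by (apply Rmult_lt_0_compat; auto).
generalize (filter_and _ _ (p_infty_gt 1) 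
  (p_infty_exp_ln al (e * al) Hal Hea)).
apply filter_imp; intros x (Hx1 & H); split; [lra|].
destruct (domination_Q_bounds x) as [_ [A B]]; [lra|].
rewrite Rabs_left1 by auto.
apply ln_increasing in Hx1; [|lra]; rewrite ln_1 in Hx1.
rewrite Rabs_pos_eq in H by lra.
apply Rle_lt_trans with (/ al * exp (- (al * ln x))); [lra|].
replace (- al * ln x) with (- (al * ln x)) in H by ring.
apply Rmult_lt_reg_l with al; auto; rewrite <- Rmult_assoc, Rinv_r; lra.
Qed.

(** Two integrals over large intervals differ by two end pieces, each bounded by an increment of
    [Q]; since [Q] converges at both ends this is the Cauchy criterion. The total increment 1/al of
    [Q] gives the bound on the limit. *)
Lemma dominated_integral :
  exists l : C, is_integral_0_oo f l /\ Cmod l <= 4 * K / al.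
Proof.
pose proof domination_K_pos as HK0.
assert (Hia : 0 < / al) by (apply Rinv_0_lt_compat; auto).
set (F := filter_prod (at_right 0) (Rbar_locally p_infty)).
set (I := fun ab : R * R => RCInt f (fst ab) (snd ab)).
assert (HF : ProperFilter F) by apply filter_prod_proper.
destruct (proj1 (filterlim_locally_cauchy (U := C_R_CompleteNormedModule)
  (F := F) I)) as [l Hl].
{ intros e.
  (* Each of the two end pieces is at most 4K times 2d; the +1 covers K = 0. *)
  set (d := e / (16 * K + 1)).
  assert (He := cond_pos e).
  assert (Hd : 0 < d) by (apply Rdiv_lt_0_compat; lra).
  assert (Hd' : d * (16 * K + 1) = e) by (unfold d; field; lra).
  exists (fun ab => (0 < fst ab /\ Rabs (Q (fst ab) + / al) < d) /\
                    (0 < snd ab /\ Rabs (Q (snd ab)) < d)); split.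
  - eapply filter_prod_of; [apply at_right_0_Q, Hd | apply p_infty_Q, Hd|].
    intros a b H1 H2; split; assumption.
  - intros [a b] [a' b'] [[Ha Hqa] [Hb Hqb]] [[Ha' Hqa'] [Hb' Hqb']].
    unfold I; simpl in *.
    apply (C_NormedModule_mixin_compat1 (RCInt f a b) (RCInt f a' b')).
    change (Cmod (RCInt f a' b' - RCInt f a b) < e).
    replace (RCInt f a' b' - RCInt f a b)%C
      with (RCInt f a' a + RCInt f b b')%C.
    2:{ rewrite <- (RCInt_Chasles a' a b') by auto.
        rewrite <- (RCInt_Chasles a b b') by auto; ring. }
    apply Rle_lt_trans with (1 := Cmod_triangle _ _).
    pose proof (domination_RInt_le_abs a' a Ha' Ha) as B1.
    pose proof (domination_RInt_le_abs b b' Hb Hb') as B2.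
    assert (Rabs (Q a - Q a') <= 2 * d).
    { apply Rabs_lt_between in Hqa; apply Rabs_lt_between in Hqa'.
      apply Rabs_le; lra. }
    assert (Rabs (Q b' - Q b) <= 2 * d).
    { apply Rabs_lt_between in Hqb; apply Rabs_lt_between in Hqb'.
      apply Rabs_le; lra. }
    nra. }
exists l; split.
- intros P HP; specialize (Hl P HP).
  assert (Hpos : F (fun ab => 0 < fst ab /\ 0 < snd ab)).
  { eapply filter_prod_of; [apply at_right_pos | apply (p_infty_gt 0)|].
    simpl; auto. }
  unfold filtermap in Hl.
  change (F (fun ab => exists y : C,
    is_RInt (V := C_R_NormedModule) f (fst ab) (snd ab) y /\ P y)).
  generalize (filter_and _ _ Hl Hpos); apply filter_imp.
  intros [a b] [H1 [Ha Hb]]; exists (RCInt f a b); split; auto.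
  apply is_RCInt; intros x Hx; apply Hf, (pos_between a b); auto.
- apply le_epsilon; intros e He.
  assert (H1 : F (fun ab => Cmod (I ab - l) < e)).
  { apply (filterlim_C_iff F I l); auto. }
  assert (H2 : F (fun ab => (0 < fst ab /\ fst ab < 1) /\ 1 < snd ab)).
  { eapply filter_prod_of;
      [apply filter_and; [apply at_right_pos | apply at_right_lt_1]
      | apply (p_infty_gt 1)|]; simpl; auto. }
  destruct (filter_ex _ (filter_and _ _ H1 H2)) as [[a b] [H3 [[Ha Ha1] Hb]]].
  unfold I in H3; simpl in *.
  replace l with (RCInt f a b - (RCInt f a b - l))%C by ring.
  apply Rle_trans with (1 := Cmod_triangle _ _); rewrite Cmod_opp.
  apply Rplus_le_compat; [|lra].
  assert (Hab : a <= b) by lra.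
  apply Rle_trans with (1 := domination_RInt_le a b Ha Hab).
  destruct (domination_Q_bounds a) as [[A _] _]; auto.
  destruct (domination_Q_bounds b) as [_ [_ B]]; [lra|].
  unfold Rdiv; apply Rmult_le_compat_l; lra.
Qed.

End Domination.

Lemma is_integral_0_oo_ext (f g : R -> C) (l : C) :
  (forall x, 0 < x -> f x = g x) ->
  is_integral_0_oo f l -> is_integral_0_oo g l.
Proof.
intros H; apply is_RInt_gen_ext.
eapply filter_prod_of; [apply at_right_pos | apply (p_infty_gt 0)|].
intros a b Ha Hb x Hx; apply H, (pos_between a b); simpl in *; auto; lra.
Qed.

Lemma is_integral_0_oo_plus (f g : R -> C) (k l : C) :
  is_integral_0_oo f k -> is_integral_0_oo g l ->
  is_integral_0_oo (fun x => f x + g x)%C (k + l).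
Proof. exact (is_RInt_gen_plus (V := C_R_NormedModule) f g k l). Qed.

Lemma is_integral_0_oo_minus (f g : R -> C) (k l : C) :
  is_integral_0_oo f k -> is_integral_0_oo g l ->
  is_integral_0_oo (fun x => f x - g x)%C (k - l).
Proof. exact (is_RInt_gen_minus (V := C_R_NormedModule) f g k l). Qed.

Lemma is_RInt_Cmult (c : C) (f : R -> C) (a b : R) (l : C) :
  is_RInt (V := C_R_NormedModule) f a b l ->
  is_RInt (V := C_R_NormedModule) (fun x => c * f x)%C a b (c * l)%C.
Proof.
intros H.
pose proof (is_RInt_fct_extend_fst (U := R_NormedModule) (V := R_NormedModule)
  f a b l H) as H1.
pose proof (is_RInt_fct_extend_snd (U := R_NormedModule) (V := R_NormedModule)
  f a b l H) as H2.
apply (is_RInt_fct_extend_pair (U := R_NormedModule) (V := R_NormedModule)).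
- apply (is_RInt_minus (V := R_NormedModule)
    (fun t => fst c * fst (f t)) (fun t => snd c * snd (f t))
    a b (fst c * fst l) (snd c * snd l));
    apply (is_RInt_scal (V := R_NormedModule)); assumption.
- apply (is_RInt_plus (V := R_NormedModule)
    (fun t => fst c * snd (f t)) (fun t => snd c * fst (f t))
    a b (fst c * snd l) (snd c * fst l));
    apply (is_RInt_scal (V := R_NormedModule)); assumption.
Qed.

Lemma CC_continuous_Cmult (c z : C) : CC_continuous (Cmult c) z.
Proof.
apply is_Cderive_continuous with (0 * z + c * 1)%C.
apply (is_Cderive_mult (fun _ => c) (fun w => w)).
- apply is_Cderive_const.
- apply is_Cderive_id.
Qed.

Lemma is_integral_0_oo_Cmult (c : C) (f : R -> C) (l : C) :
  is_integral_0_oo f l -> is_integral_0_oo (fun x => c * f x)%C (c * l).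
Proof.
intros H P HP.
generalize (H _ (CC_continuous_Cmult c l P HP)); unfold filtermapi.
apply filter_imp.
intros [a b] [y [Hy HPy]]; exists (c * y)%C; split; auto.
apply is_RInt_Cmult, Hy.
Qed.

(** Both integrations by parts below use this with A = B = 0: the derivative of a product that
    vanishes at both ends has integral zero. *)
Lemma is_integral_0_oo_derive (F f : R -> C) (A B : C) :
  (forall x, 0 < x -> is_RCderive F x (f x)) ->
  (forall x, 0 < x -> RC_continuous f x) ->
  filterlim F (at_right 0) (locally (T := C_UniformSpace) A) ->
  filterlim F (Rbar_locally p_infty) (locally (T := C_UniformSpace) B) ->
  is_integral_0_oo f (B - A).
Proof.
intros HF Hf HA HB P HP; apply locally_C_iff in HP.
destruct HP as [e [He HP]].
assert (He2 : 0 < e / 2) by lra.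
rewrite filterlim_C_iff in HA, HB by typeclasses eauto.
eapply filter_prod_of.
- apply filter_and; [apply at_right_pos | apply (HA _ He2)].
- apply filter_and; [apply (p_infty_gt 0) | apply (HB _ He2)].
- intros a b [Ha Hda] [Hb Hdb]; exists (F b - F a)%C; split.
  + apply (is_RInt_derive (V := C_R_CompleteNormedModule)); simpl;
      intros x Hx; apply (pos_between a b x Ha Hb) in Hx.
    * apply HF, Hx.
    * apply Hf, Hx.
  + apply HP; replace (F b - F a - (B - A))%C
      with ((F b - B) + - (F a - A))%C by ring.
    apply Rle_lt_trans with (1 := Cmod_triangle _ _); rewrite Cmod_opp; lra.
Qed.

Lemma Cmod_exp_ln_vanishes (F : R -> C) (al K : R) :
  0 < al ->
  (forall x, 0 < x -> Cmod (F x) <= K * exp (- al * Rabs (ln x))) ->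
  filterlim F (at_right 0) (locally (T := C_UniformSpace) (RtoC 0)) /\
  filterlim F (Rbar_locally p_infty) (locally (T := C_UniformSpace) (RtoC 0)).
Proof.
intros Hal HK.
assert (HK0 : 0 <= K).
{ specialize (HK 1 Rlt_0_1); rewrite ln_1, Rabs_R0, Rmult_0_r, exp_0 in HK.
  pose proof (Cmod_ge_0 (F 1)); lra. }
assert (H : forall e x, 0 < e -> 0 < x ->
  exp (- al * Rabs (ln x)) < e / (K + 1) -> Cmod (F x - 0) < e).
{ intros e x He Hx H; replace (F x - 0)%C with (F x) by ring.
  apply Rle_lt_trans with (1 := HK x Hx).
  apply (Rmult_lt_compat_r (K + 1)) in H; [|lra].
  unfold Rdiv in H; rewrite Rmult_assoc, Rinv_l in H by lra.
  pose proof (exp_pos (- al * Rabs (ln x))); nra. }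
split; apply filterlim_C_iff; try typeclasses eauto; intros e He;
  assert (Hd : 0 < e / (K + 1)) by (apply Rdiv_lt_0_compat; lra).
- generalize (filter_and _ _ at_right_pos (at_right_0_exp_ln al _ Hal Hd)).
  apply filter_imp; intros x [Hx Hx']; apply (H e x); assumption.
- generalize (filter_and _ _ (p_infty_gt 0) (p_infty_exp_ln al _ Hal Hd)).
  apply filter_imp; intros x [Hx Hx']; apply (H e x); assumption.
Qed.

(** The majorant is integrated as a complex function so that the linearity lemmas above also compute
    its integral. The comparison is made on one interval on which both integrals are within e/2 of
    their limits. *)
Lemma is_integral_0_oo_le (f : R -> C) (g : R -> R) (k : C) (l : R) :
  is_integral_0_oo f k -> is_integral_0_oo (fun x => RtoC (g x)) l ->
  (forall x, 0 < x -> Cmod (f x) <= g x) -> Cmod k <= l.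
Proof.
intros Hf Hg Hfg; apply le_epsilon; intros e He.
assert (He2 : 0 < e / 2) by lra.
set (U (z : C) := fun w : C => Cmod (w - z) < e / 2).
assert (HU : forall z, locally (T := C_UniformSpace) z (U z)).
{ intros z; apply locally_C_iff; exists (e / 2); auto. }
assert (H : filter_prod (at_right 0) (Rbar_locally p_infty)
  (fun ab => (0 < fst ab /\ fst ab < 1) /\ 1 < snd ab)).
{ eapply filter_prod_of;
    [apply filter_and; [apply at_right_pos | apply at_right_lt_1]
    | apply (p_infty_gt 1)|]; simpl; auto. }
pose proof (Hf _ (HU k)) as Hfk; pose proof (Hg _ (HU (RtoC l))) as Hgl.
unfold filtermapi in Hfk, Hgl.
destruct (filter_ex _ (filter_and _ _ H (filter_and _ _ Hfk Hgl)))
  as [[a b] [[[Ha Ha1] Hb] [[y [Hy Hyk]] [z [Hz Hzl]]]]].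
simpl in *; unfold U in *.
assert (Hyz : Cmod y <= Re z).
{ rewrite <- norm_C_R.
  apply (norm_RInt_le (V := C_R_NormedModule) f g a b); [lra| |exact Hy|].
  - intros x Hx; rewrite norm_C_R; apply Hfg; lra.
  - apply (is_RInt_fct_extend_fst (U := R_NormedModule) (V := R_NormedModule)
      (fun x => RtoC (g x)) a b z Hz). }
replace k with (y - (y - k))%C by ring.
apply Rle_trans with (1 := Cmod_triangle _ _); rewrite Cmod_opp.
pose proof (re_le_Cmod (z - l)) as B.
rewrite re_minus, re_RtoC in B; apply Rabs_le_between in B; lra.
Qed.

(** * Differentiation of Mellin transforms *)

Lemma Rcpow_plus (x : R) (u v : C) :
  Rcpow x (u + v) = (Rcpow x u * Rcpow x v)%C.
Proof. unfold Rcpow; rewrite <- Cexp_plus; f_equal; ring. Qed.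

Lemma Rcpow_0 (x : R) : Rcpow x 0 = 1.
Proof. unfold Rcpow; rewrite <- Cexp_0; f_equal; ring. Qed.

Lemma Cmod_Rcpow (x : R) (w : C) : Cmod (Rcpow x w) = exp (Re w * ln x).
Proof. unfold Rcpow; rewrite Cmod_Cexp, re_scal_r; reflexivity. Qed.

Lemma Rcpow_neq_0 (x : R) (w : C) : Rcpow x w <> 0.
Proof.
apply Cmod_gt_0; rewrite Cmod_Rcpow; apply exp_pos.
Qed.

Lemma Rcpow_1 (x : R) : 0 < x -> Rcpow x 1 = x.
Proof.
intros Hx; unfold Rcpow; rewrite <- RtoC_mult, Cexp_RtoC.
rewrite Rmult_1_l, exp_ln by auto; reflexivity.
Qed.

Lemma Rcpow_INR (x : R) (n : nat) : 0 < x -> Rcpow x (INR n) = (x ^ n)%R.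
Proof.
intros Hx; induction n as [|n IH]; [apply Rcpow_0|].
rewrite S_INR, RtoC_plus, Rcpow_plus, IH, Rcpow_1 by auto.
rewrite <- RtoC_mult; f_equal; simpl; ring.
Qed.

Lemma is_RCderive_Rcpow (x : R) (w : C) :
  0 < x -> is_RCderive (fun t => Rcpow t w) x (w * Rcpow x (w - 1)).
Proof.
intros Hx.
replace (w * Rcpow x (w - 1))%C with (w * / RtoC x * Rcpow x w)%C.
2:{ replace (Rcpow x w) with (Rcpow x (w - 1 + 1)) by (f_equal; ring).
    rewrite Rcpow_plus, Rcpow_1 by auto; field.
    intros E; apply RtoC_inj in E; lra. }
rewrite <- RtoC_inv by lra.
apply is_RCderive_pair; unfold Rcpow, Cexp; simpl; unfold Re, Im; simpl;
  auto_derive; auto; unfold Rminus; field; lra.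
Qed.

Lemma RC_continuous_Rcpow (x : R) (w : C) :
  0 < x -> RC_continuous (fun t => Rcpow t w) x.
Proof.
intros Hx; eapply RC_continuous_is_RCderive, is_RCderive_Rcpow, Hx.
Qed.

Lemma RC_continuous_ln (x : R) : 0 < x -> RC_continuous (fun t => RtoC (ln t)) x.
Proof.
intros Hx; apply RC_continuous_RtoC.
apply (ex_derive_continuous (K := R_AbsRing) (V := R_NormedModule)).
auto_derive; auto.
Qed.

Lemma Rmult_Rabs_exp_le (d y : R) :
  0 < d -> Rabs y <= / d * exp (d * Rabs y).
Proof.
intros Hd; apply Rmult_le_reg_l with d; auto.
rewrite <- Rmult_assoc, Rinv_r, Rmult_1_l by lra.
pose proof (exp_ineq1_le (d * Rabs y)); lra.
Qed.

Section MellinDerivative.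

Variables (G : C -> R -> C) (s : C) (al K : R).
Hypothesis HG :
  forall h x, 0 < x -> G (s + h) x = (G s x * Rcpow x h)%C.
Hypothesis Hc : forall x, 0 < x -> RC_continuous (G s) x.
Hypothesis Hal : 0 < al.
Hypothesis HK :
  forall x, 0 < x -> x * Cmod (G s x) <= K * exp (- al * Rabs (ln x)).

(** In [mellin_remainder] the rate al pays for three factors e^(d |ln x|): one for x^h with |h| <= d
    and one for each of two logarithms. The decay rate left over is al - 3d = d. *)
Let d := al / 4.

Lemma mellin_converges : is_integral_0_oo (G s) (integral_0_oo (G s)).
Proof.
destruct (dominated_integral (G s) al K Hc Hal HK) as [l [Hl _]].
rewrite (is_integral_0_oo_unique _ _ Hl); exact Hl.
Qed.

Lemma mellin_log_converges :
  exists l, is_integral_0_oo (fun x => ln x * G s x)%C l.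
Proof.
assert (Hd : 0 < d) by (unfold d; lra).
destruct (dominated_integral (fun x => ln x * G s x)%C (al - d) (K / d))
  as [l [Hl _]]; [| | |exists l; exact Hl].
- intros x Hx; apply RC_continuous_mult; auto; apply RC_continuous_ln, Hx.
- unfold d; lra.
- intros x Hx; rewrite Cmod_mult, Cmod_R.
  replace (- (al - d) * Rabs (ln x))
    with (- al * Rabs (ln x) + d * Rabs (ln x)) by ring.
  rewrite exp_plus.
  replace (x * (Rabs (ln x) * Cmod (G s x)))
    with ((x * Cmod (G s x)) * Rabs (ln x)) by ring.
  replace (K / d * (exp (- al * Rabs (ln x)) * exp (d * Rabs (ln x))))
    with ((K * exp (- al * Rabs (ln x))) * (/ d * exp (d * Rabs (ln x))))
    by (field; lra).
  apply Rmult_le_compat; auto.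
  + apply Rmult_le_pos; [lra | apply Cmod_ge_0].
  + apply Rabs_pos.
  + apply Rmult_Rabs_exp_le, Hd.
Qed.

(** By [Cexp_taylor1], |x^h - 1 - h ln x| <= |h ln x|^2 e^(|h| |ln x|). The result is again a
    dominated integrand, with a constant quadratic in h. *)
Lemma mellin_remainder (h : C) :
  Cmod h <= d ->
  exists l,
    is_integral_0_oo (fun x => G s x * (Rcpow x h - 1 - h * ln x))%C l /\
    Cmod l <= 4 * (K * Cmod h ^ 2 / d ^ 2) / d.
Proof.
intros Hh; assert (Hd : 0 < d) by (unfold d; lra).
apply dominated_integral; auto.
- intros x Hx; apply RC_continuous_mult; auto.
  apply RC_continuous_minus; [apply RC_continuous_minus|].
  + apply RC_continuous_Rcpow, Hx.
  + apply RC_continuous_const.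
  + apply RC_continuous_mult; [apply RC_continuous_const|].
    apply RC_continuous_ln, Hx.
- intros x Hx; rewrite Cmod_mult.
  set (L := Rabs (ln x)).
  replace (- d * L) with (- al * L + (d * L + d * L + d * L))
    by (unfold d; field).
  rewrite exp_plus.
  replace (x * (Cmod (G s x) * Cmod (Rcpow x h - 1 - h * ln x)))
    with ((x * Cmod (G s x)) * Cmod (Rcpow x h - 1 - h * ln x)) by ring.
  replace (K * Cmod h ^ 2 / d ^ 2 *
      (exp (- al * L) * exp (d * L + d * L + d * L)))
    with ((K * exp (- al * L)) *
      (Cmod h ^ 2 * (/ d * (/ d * exp (d * L + d * L + d * L)))))
    by (field; lra).
  apply Rmult_le_compat.
  + apply Rmult_le_pos; [lra | apply Cmod_ge_0].
  + apply Cmod_ge_0.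
  + apply HK, Hx.
  + apply Rle_trans with (1 := Cexp_taylor1 (h * ln x)).
    rewrite Cmod_mult, Cmod_R; fold L.
    assert (HL : 0 <= L) by apply Rabs_pos.
    assert (HL1 : L <= / d * exp (d * L)).
    { pose proof (Rmult_Rabs_exp_le d L Hd) as B.
      rewrite Rabs_pos_eq in B by auto; exact B. }
    assert (HE : exp (Cmod h * L) <= exp (d * L)).
    { apply exp_le, Rmult_le_compat_r; auto. }
    rewrite Rpow_mult_distr, Rmult_assoc.
    apply Rmult_le_compat_l; [apply pow2_ge_0|].
    rewrite 2!exp_plus.
    replace (/ d * (/ d * (exp (d * L) * exp (d * L) * exp (d * L))))
      with ((/ d * exp (d * L)) ^ 2 * exp (d * L)) by ring.
    apply Rmult_le_compat; auto; [apply pow2_ge_0 | left; apply exp_pos |].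
    apply pow_incr; auto.
Qed.

(** The derivative is the integral of ln x times the integrand: by [HG], the transform at s + h is
    the transform at s plus h times that integral plus a remainder of order |h|^2. *)
Lemma mellin_is_Cderive :
  exists l, is_Cderive (fun z => integral_0_oo (G z)) s l.
Proof.
assert (Hd : 0 < d) by (unfold d; lra).
assert (HK0 : 0 <= K) by exact (domination_K_pos (G s) al K HK).
destruct mellin_log_converges as [l Hl].
exists l; apply is_Cderive_iff; intros e He.
(* The coefficient of |h|^2 in the bound of [mellin_remainder]. *)
set (c := 4 * K / d ^ 3).
assert (Hd3 : 0 < d ^ 3) by (apply pow_lt; auto).
assert (Hcpos : 0 <= c) by (apply Rle_mult_inv_pos; lra).
exists (Rmin d (e / (c + 1))); split.
- apply Rmin_pos; auto; apply Rdiv_lt_0_compat; lra.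
- intros w Hw.
  set (h := (w - s)%C) in *.
  assert (Hw1 := Rlt_le_trans _ _ _ Hw (Rmin_l _ _)).
  assert (Hw2 := Rlt_le_trans _ _ _ Hw (Rmin_r _ _)).
  destruct (mellin_remainder h) as [r [Hr Hrb]]; [lra|].
  assert (HI : is_integral_0_oo (G w) (r + integral_0_oo (G s) + h * l)).
  { eapply is_integral_0_oo_ext; cycle 1.
    - apply is_integral_0_oo_plus; [apply is_integral_0_oo_plus|].
      + exact Hr.
      + apply mellin_converges.
      + apply is_integral_0_oo_Cmult, Hl.
    - intros x Hx; simpl.
      replace w with (s + h)%C by (unfold h; ring).
      rewrite HG by auto; ring. }
  rewrite (is_integral_0_oo_unique _ _ HI).
  replace (r + integral_0_oo (G s) + h * l - integral_0_oo (G s) - h * l)%C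
    with r by ring.
  apply Rle_trans with (1 := Hrb).
  replace (4 * (K * Cmod h ^ 2 / d ^ 2) / d) with (c * Cmod h * Cmod h)
    by (unfold c; field; lra).
  apply Rmult_le_compat_r; [apply Cmod_ge_0|].
  apply (Rmult_lt_compat_r (c + 1)) in Hw2; [|lra].
  unfold Rdiv in Hw2; rewrite Rmult_assoc, Rinv_l in Hw2 by lra.
  pose proof (Cmod_ge_0 h); nra.
Qed.

End MellinDerivative.

(** * Taylor remainder of the exponential *)

(** Lagrange's remainder at 0. The intermediate point is kept, since [phi_bounds] compares e^-y with
    e^-x. *)
Lemma exp_minus_T (M : nat) (x : R) :
  0 < x -> exists y, 0 < y < x /\
    exp x - T M x = x ^ S M / INR (fact (S M)) * exp y.
Proof.
intros Hx.
assert (Hd : forall n t, Derive_n exp n t = exp t).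
{ intros n t; apply is_derive_n_unique, is_derive_n_exp. }
destruct (Taylor_Lagrange exp M 0 x Hx) as [y [Hy H]].
{ intros t _ [|k] _; [exact I|].
  exists (exp t); apply (is_derive_n_exp (S k)). }
exists y; split; auto.
rewrite H, Rminus_0_r, Hd; unfold T.
rewrite (sum_eq _ (fun k => x ^ k / INR (fact k))).
- ring.
- intros i _; rewrite Hd, exp_0; ring.
Qed.

Lemma T_pos (M : nat) (x : R) : 0 < x -> 0 <= T M x.
Proof.
intros Hx; apply cond_pos_sum; intros k.
apply Rle_mult_inv_pos; [apply pow_le; lra | apply INR_fact_lt_0].
Qed.

Lemma pow_div_fact_le_exp (k : nat) (x : R) :
  0 < x -> x ^ k / INR (fact k) <= exp x.
Proof.
intros Hx; destruct k as [|k].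
- simpl; pose proof (exp_ineq1 x); lra.
- destruct (exp_minus_T k x Hx) as [y [Hy H]].
  pose proof (T_pos k x Hx).
  assert (0 <= x ^ S k / INR (fact (S k))).
  { apply Rle_mult_inv_pos; [apply pow_le; lra | apply INR_fact_lt_0]. }
  pose proof (exp_ineq1 y); nra.
Qed.

Lemma exp_neg_pow_le (k : nat) (x : R) :
  0 < x -> exp (- x) * x ^ k <= INR (fact k).
Proof.
intros Hx; pose proof (pow_div_fact_le_exp k x Hx) as H.
pose proof (INR_fact_lt_0 k) as Hk.
rewrite exp_Ropp; apply Rmult_le_reg_l with (exp x); [apply exp_pos|].
rewrite <- Rmult_assoc, Rinv_r, Rmult_1_l
  by (pose proof (exp_pos x); lra).
apply (Rmult_le_compat_r (INR (fact k))) in H; [|lra].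
unfold Rdiv in H; rewrite Rmult_assoc, Rinv_l in H; lra.
Qed.

(** * Mellin transforms of rapidly decreasing functions *)

(** The exponent k = 0 makes [phi] bounded near 0, the larger ones make it decay at infinity;
    together they place the Mellin transform on the whole of Re s > 0. *)
Definition rapidly_decreasing (phi : R -> C) : Prop :=
  (forall x, 0 < x -> RC_continuous phi x) /\
  forall k : nat, exists B, forall x, 0 < x -> Cmod (phi x) * x ^ k <= B.

Definition mellin (phi : R -> C) (s : C) : C :=
  integral_0_oo (fun x => phi x * Rcpow x (s - 1))%C.

Lemma exp_INR_ln (k : nat) (x : R) : 0 < x -> exp (INR k * ln x) = x ^ k.
Proof.
intros Hx; rewrite <- (Rpower_pow k x Hx); reflexivity.
Qed.

Lemma rapidly_decreasing_bound (phi : R -> C) (a : R) :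
  rapidly_decreasing phi -> 0 < a ->
  exists K, forall x, 0 < x ->
    Cmod (phi x) * exp (a * ln x) <= K * exp (- a * Rabs (ln x)).
Proof.
intros [_ H] Ha.
(* For x > 1 the target needs x^a <= x^k x^(-a), hence k >= 2a; for x <= 1 boundedness suffices, as
   x^a is already e^(-a |ln x|). *)
destruct (INR_unbounded (2 * a)) as [k Hk].
destruct (H 0%nat) as [A HA]; destruct (H k) as [B HB].
exists (Rmax A B); intros x Hx.
specialize (HA x Hx); specialize (HB x Hx).
rewrite pow_O, Rmult_1_r in HA.
pose proof (Cmod_ge_0 (phi x)).
pose proof (Rmax_l A B); pose proof (Rmax_r A B).
destruct (Rle_dec (ln x) 0) as [HL|HL].
- rewrite Rabs_left1 by auto.
  replace (- a * - ln x) with (a * ln x) by ring.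
  apply Rmult_le_compat_r; [left; apply exp_pos | lra].
- apply Rnot_le_lt in HL; rewrite Rabs_pos_eq by lra.
  assert (E : exp (a * ln x) <= x ^ k * exp (- a * ln x)).
  { rewrite <- exp_INR_ln, <- exp_plus by auto; apply exp_le; nra. }
  apply Rle_trans with (Cmod (phi x) * (x ^ k * exp (- a * ln x))).
  + apply Rmult_le_compat_l; auto.
  + rewrite <- Rmult_assoc; apply Rmult_le_compat_r;
      [left; apply exp_pos | lra].
Qed.

Lemma mellin_integrand_bound (phi : R -> C) (s : C) :
  rapidly_decreasing phi -> 0 < Re s ->
  exists K, forall x, 0 < x ->
    x * Cmod (phi x * Rcpow x (s - 1)) <= K * exp (- Re s * Rabs (ln x)).
Proof.
intros Hphi Hs.
destruct (rapidly_decreasing_bound phi (Re s) Hphi Hs) as [K HK].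
exists K; intros x Hx.
apply Rle_trans with (2 := HK x Hx); right.
rewrite Cmod_mult, Cmod_Rcpow, re_minus, re_RtoC.
rewrite <- (exp_ln x) at 1 by auto.
replace (Re s * ln x) with (ln x + (Re s - 1) * ln x) by ring.
rewrite exp_plus; ring.
Qed.

Lemma mellin_integrand_continuous (phi : R -> C) (s : C) (x : R) :
  rapidly_decreasing phi -> 0 < x ->
  RC_continuous (fun x => phi x * Rcpow x (s - 1))%C x.
Proof.
intros [H _] Hx; apply RC_continuous_mult; auto.
apply RC_continuous_Rcpow, Hx.
Qed.

Lemma is_integral_mellin (phi : R -> C) (s : C) :
  rapidly_decreasing phi -> 0 < Re s ->
  is_integral_0_oo (fun x => phi x * Rcpow x (s - 1))%C (mellin phi s).
Proof.
intros Hphi Hs.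
destruct (mellin_integrand_bound phi s Hphi Hs) as [K HK].
apply (mellin_converges (fun s x => phi x * Rcpow x (s - 1))%C s (Re s) K);
  auto; intros x Hx; apply mellin_integrand_continuous; auto.
Qed.

Lemma ex_Cderive_mellin (phi : R -> C) (s : C) :
  rapidly_decreasing phi -> 0 < Re s ->
  exists l, is_Cderive (mellin phi) s l.
Proof.
intros Hphi Hs.
destruct (mellin_integrand_bound phi s Hphi Hs) as [K HK].
apply (mellin_is_Cderive (fun s x => phi x * Rcpow x (s - 1))%C s (Re s) K);
  auto.
- intros h x Hx; replace (s + h - 1)%C with (s - 1 + h)%C by ring.
  rewrite Rcpow_plus; ring.
- intros x Hx; apply mellin_integrand_continuous; auto.
Qed.

(** * The Gamma integral and its functional equation *)

Lemma exp_neg_rapidly_decreasing : rapidly_decreasing (fun x => RtoC (exp (- x))).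
Proof.
split.
- intros x _; apply RC_continuous_RtoC.
  apply (ex_derive_continuous (K := R_AbsRing) (V := R_NormedModule)).
  auto_derive; auto.
- intros k; exists (INR (fact k)); intros x Hx.
  rewrite Cmod_R, Rabs_pos_eq by (left; apply exp_pos).
  apply exp_neg_pow_le, Hx.
Qed.

Lemma is_integral_Gamma (z : C) :
  0 < Re z ->
  is_integral_0_oo (fun x => exp (- x) * Rcpow x (z - 1))%C (Gamma z).
Proof. exact (is_integral_mellin _ z exp_neg_rapidly_decreasing). Qed.

Lemma ex_Cderive_Gamma (z : C) : 0 < Re z -> exists l, is_Cderive Gamma z l.
Proof. exact (ex_Cderive_mellin _ z exp_neg_rapidly_decreasing). Qed.

Lemma is_RCderive_Re (f : R -> C) (x : R) (l : C) :
  is_RCderive f x l -> is_derive (fun t => Re (f t)) x (Re l).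
Proof.
intros [_ H]; split; [apply is_linear_scal_l|].
intros y Hy e; generalize (H y Hy e); apply filter_imp; intros t.
rewrite norm_C_R; intros K.
exact (Rle_trans _ _ _ (re_le_Cmod (minus (G := C_R_NormedModule)
  (minus (f t) (f y)) (scal (minus t y) l))) K).
Qed.

Lemma is_RCderive_Im (f : R -> C) (x : R) (l : C) :
  is_RCderive f x l -> is_derive (fun t => Im (f t)) x (Im l).
Proof.
intros [_ H]; split; [apply is_linear_scal_l|].
intros y Hy e; generalize (H y Hy e); apply filter_imp; intros t.
rewrite norm_C_R; intros K.
exact (Rle_trans _ _ _ (im_le_Cmod (minus (G := C_R_NormedModule)
  (minus (f t) (f y)) (scal (minus t y) l))) K).
Qed.

Lemma is_RCderive_mult (f g : R -> C) (x : R) (k l : C) :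
  is_RCderive f x k -> is_RCderive g x l ->
  is_RCderive (fun t => f t * g t)%C x (k * g x + f x * l)%C.
Proof.
intros Hf Hg.
pose proof (is_RCderive_Re _ _ _ Hf) as f1.
pose proof (is_RCderive_Im _ _ _ Hf) as f2.
pose proof (is_RCderive_Re _ _ _ Hg) as g1.
pose proof (is_RCderive_Im _ _ _ Hg) as g2.
apply is_RCderive_pair.
- replace (Re (k * g x + f x * l)) with
    ((Re k * Re (g x) + Re (f x) * Re l) - (Im k * Im (g x) + Im (f x) * Im l))
    by (unfold Re, Im; simpl; ring).
  apply (is_derive_minus (V := R_NormedModule) (fun t => Re (f t) * Re (g t))
    (fun t => Im (f t) * Im (g t))); apply (is_derive_mult (K := R_AbsRing));
    auto; intros; apply Rmult_comm.
- replace (Im (k * g x + f x * l)) with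
    ((Re k * Im (g x) + Re (f x) * Im l) + (Im k * Re (g x) + Im (f x) * Re l))
    by (unfold Re, Im; simpl; ring).
  apply (is_derive_plus (V := R_NormedModule) (fun t => Re (f t) * Im (g t))
    (fun t => Im (f t) * Re (g t))); apply (is_derive_mult (K := R_AbsRing));
    auto; intros; apply Rmult_comm.
Qed.

Lemma Gamma_plus_1 (z : C) : 0 < Re z -> Gamma (z + 1) = (z * Gamma z)%C.
Proof.
intros Hz.
destruct (rapidly_decreasing_bound _ _ exp_neg_rapidly_decreasing Hz) as [K HK].
set (F := fun x : R => (exp (- x) * Rcpow x z)%C).
set (f := fun x : R =>
  (- (1) * exp (- x) * Rcpow x z + exp (- x) * (z * Rcpow x (z - 1)))%C).
destruct (Cmod_exp_ln_vanishes F (Re z) K Hz) as [H0 Hoo].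
{ intros x Hx; unfold F; rewrite Cmod_mult, Cmod_Rcpow; auto. }
assert (H : is_integral_0_oo f (0 - 0)).
{ apply is_integral_0_oo_derive with (F := F); auto.
  - intros x Hx; apply (is_RCderive_mult (fun x => RtoC (exp (- x)))
      (fun x => Rcpow x z)); [|apply is_RCderive_Rcpow, Hx].
    apply is_RCderive_pair; simpl; auto_derive; auto; ring.
  - intros x Hx; unfold f.
    apply RC_continuous_plus; apply RC_continuous_mult.
    + apply RC_continuous_mult; [apply RC_continuous_const|].
      apply (proj1 exp_neg_rapidly_decreasing x Hx).
    + apply RC_continuous_Rcpow, Hx.
    + apply (proj1 exp_neg_rapidly_decreasing x Hx).
    + apply RC_continuous_mult; [apply RC_continuous_const|].
      apply RC_continuous_Rcpow, Hx. }
assert (Hz1 : 0 < Re (z + 1)) by (rewrite re_plus, re_RtoC; lra).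
(* The derivative of e^-x x^z, integrated to zero above through its boundary values, is now
   integrated term by term. *)
assert (H' : is_integral_0_oo f (z * Gamma z - Gamma (z + 1))).
{ eapply is_integral_0_oo_ext; cycle 1.
  - apply is_integral_0_oo_minus.
    + apply is_integral_0_oo_Cmult, is_integral_Gamma, Hz.
    + apply is_integral_Gamma, Hz1.
  - intros x Hx; unfold f; simpl.
    replace (z + 1 - 1)%C with z by ring; ring. }
apply is_integral_0_oo_unique in H; apply is_integral_0_oo_unique in H'.
rewrite H in H'.
replace (Gamma (z + 1)) with (z * Gamma z - (z * Gamma z - Gamma (z + 1)))%C
  by ring.
rewrite <- H'; ring.
Qed.

(** * Nonvanishing of Gamma *)

Lemma Gamma_1 : Gamma 1 = 1.
Proof.
apply (is_integral_0_oo_unique (fun x => exp (- x) * Rcpow x (1 - 1))%C).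
apply (is_integral_0_oo_ext (fun x => RtoC (exp (- x)))).
{ intros x _; replace (1 - 1)%C with (RtoC 0) by ring.
  rewrite Rcpow_0; ring. }
replace (RtoC 1) with (0 - - (1))%C by ring.
apply (is_integral_0_oo_derive (fun x => (- RtoC (exp (- x)))%C)
  (fun x => RtoC (exp (- x))) (- (1))%C 0).
- intros x _; apply is_RCderive_pair; simpl; auto_derive; auto; ring.
- apply (proj1 exp_neg_rapidly_decreasing).
- apply filterlim_C_iff; try typeclasses eauto; intros e He.
  apply Rlocally_iff; exists e; split; auto; intros x Hx Hx0.
  rewrite Rminus_0_r, Rabs_pos_eq in Hx by lra.
  replace (- exp (- x) - - (1))%C with (RtoC (1 - exp (- x)))
    by (rewrite RtoC_minus; ring).
  pose proof (exp_ineq1_le (- x)).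
  assert (exp (- x) <= 1) by (rewrite <- exp_0; apply exp_le; lra).
  rewrite Cmod_R, Rabs_pos_eq; lra.
- apply filterlim_C_iff; try typeclasses eauto; intros e He.
  exists (/ e); intros x Hx.
  assert (He' : 0 < / e) by (apply Rinv_0_lt_compat; auto).
  replace (- exp (- x) - 0)%C with (- RtoC (exp (- x)))%C by ring.
  rewrite Cmod_opp, Cmod_R, Rabs_pos_eq by (left; apply exp_pos).
  pose proof (exp_neg_pow_le 1 x) as H; simpl in H.
  apply Rmult_lt_reg_r with x; [lra|].
  apply Rle_lt_trans with 1; [lra|].
  apply (Rmult_lt_compat_l e) in Hx; auto.
  rewrite Rinv_r in Hx; lra.
Qed.

Lemma Gamma_nat (n : nat) : Gamma (INR n + 1) = INR (fact n).
Proof.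
induction n as [|n IH].
- simpl; replace (0 + 1)%C with (RtoC 1) by ring; apply Gamma_1.
- rewrite Gamma_plus_1.
  + rewrite S_INR, RtoC_plus, IH, <- RtoC_plus, <- RtoC_mult, <- S_INR.
    rewrite fact_simpl, mult_INR; reflexivity.
  + rewrite re_RtoC; apply lt_0_INR; lia.
Qed.

Lemma is_integral_exp_pow (n : nat) :
  is_integral_0_oo (fun x => RtoC (exp (- x) * x ^ n)) (INR (fact n)).
Proof.
rewrite <- Gamma_nat.
eapply is_integral_0_oo_ext; [|apply is_integral_Gamma].
- intros x Hx; simpl; replace (INR n + 1 - 1)%C with (RtoC (INR n)) by ring.
  rewrite Rcpow_INR, <- RtoC_mult by auto; reflexivity.
- simpl; pose proof (pos_INR n); lra.
Qed.

Lemma Gamma_plus_INR_0 (z : C) (n : nat) :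
  0 < Re z -> Gamma z = 0 -> Gamma (z + INR n) = 0.
Proof.
intros Hz H; induction n as [|n IH].
- simpl; rewrite Cplus_0_r; exact H.
- rewrite S_INR, RtoC_plus, Cplus_assoc, Gamma_plus_1, IH; [ring|].
  rewrite re_plus, re_RtoC; pose proof (pos_INR n); lra.
Qed.

(** With L = ln t this reads |t^a - 1| <= |t - 1|. It confines the variance argument to Re z <=
    1. *)
Lemma Rabs_exp_contract (a L : R) :
  0 < a <= 1 -> Rabs (exp (L * a) - 1) <= Rabs (exp L - 1).
Proof.
intros Ha; rewrite <- exp_0.
destruct (Rle_dec 0 L) as [HL|HL].
- assert (exp 0 <= exp (L * a)) by (apply exp_le; nra).
  assert (exp (L * a) <= exp L) by (apply exp_le; nra).
  rewrite !Rabs_pos_eq; lra.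
- assert (exp (L * a) <= exp 0) by (apply exp_le; nra).
  assert (exp L <= exp (L * a)) by (apply exp_le; nra).
  rewrite !Rabs_left1; lra.
Qed.

(* If Gamma z = 0 then Gamma (z + n) = 0 for all n; but the density
   e^-x x^(n-1) / (n-1)! has mean n and variance n, so it concentrates near
   x = n and forces Gamma (z + n) ~ n^z (n-1)!. *)
Lemma Gamma_neq_0_strip (z : C) : 0 < Re z <= 1 -> Gamma z <> 0.
Proof.
intros [Hz Hz1] H0.
set (c := Cmod z / Re z).
assert (Hc : 0 <= c) by (apply Rle_mult_inv_pos; auto; apply Cmod_ge_0).
destruct (INR_unbounded (c + 1)) as [m Hm].
assert (Hm0 : 0 < INR m) by lra.
assert (Hm1 : (1 <= m)%nat) by (apply INR_le; simpl; lra).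
(* Taking n = k + 1 = m^2 makes the standard deviation sqrt n of the density the integer m. The
   final inequality is then k! <= c k! / m, contradicting m > c + 1. *)
set (k := (m * m - 1)%nat).
assert (Hk : S k = (m * m)%nat) by (unfold k; nia).
set (n := INR m * INR m).
assert (Hn : n = INR (S k)) by (unfold n; rewrite Hk, mult_INR; reflexivity).
assert (Hn0 : 0 < n) by (unfold n; nra).
(* The deviation of (x/n)^z from its value 1 at x = n, weighted by the unnormalised density. Its
   integral is n^(-z) Gamma(z+n) - k!, which is -k! if Gamma z = 0. *)
set (f := fun x : R =>
  (RtoC (exp (- x) * x ^ k)%R * (/ Rcpow n z * Rcpow x z - 1))%C).
assert (Hf : is_integral_0_oo f
  (/ Rcpow n z * Gamma (z + INR (S k)) - INR (fact k))).
{ eapply is_integral_0_oo_ext; cycle 1.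
  - apply is_integral_0_oo_minus; [|apply is_integral_exp_pow].
    apply is_integral_0_oo_Cmult, is_integral_Gamma.
    rewrite re_plus, re_RtoC; pose proof (pos_INR (S k)); lra.
  - intros x Hx; unfold f; cbv beta.
    replace (z + INR (S k) - 1)%C with (INR k + z)%C
      by (rewrite S_INR, RtoC_plus; ring).
    rewrite Rcpow_plus, Rcpow_INR, !RtoC_mult by auto; ring. }
rewrite Gamma_plus_INR_0 in Hf by auto.
(* The majorant (c/2) (m (x/n - 1)^2 + 1/m) times the density, expanded into powers of x so that its
   integral is a combination of factorials. *)
set (g := fun x : R =>
  (c / 2) * (INR m * (/ n ^ 2 * (exp (- x) * x ^ S (S k))
     - 2 / n * (exp (- x) * x ^ S k) + exp (- x) * x ^ k)
   + / INR m * (exp (- x) * x ^ k))).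
assert (Hg : is_integral_0_oo (fun x => RtoC (g x))
  (RtoC ((c / 2) * (INR m * (/ n ^ 2 * INR (fact (S (S k)))
     - 2 / n * INR (fact (S k)) + INR (fact k))
   + / INR m * INR (fact k))))).
{ eapply is_integral_0_oo_ext; cycle 1.
  - rewrite RtoC_mult; apply is_integral_0_oo_Cmult.
    rewrite RtoC_plus; apply is_integral_0_oo_plus.
    + rewrite RtoC_mult; apply is_integral_0_oo_Cmult.
      rewrite RtoC_plus; apply is_integral_0_oo_plus;
        [|apply is_integral_exp_pow].
      rewrite RtoC_minus; apply is_integral_0_oo_minus;
        rewrite RtoC_mult; apply is_integral_0_oo_Cmult, is_integral_exp_pow.
    + rewrite RtoC_mult; apply is_integral_0_oo_Cmult, is_integral_exp_pow.
  - intros x _; unfold g; cbv beta.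
    rewrite <- !RtoC_mult, <- RtoC_minus, <- !RtoC_plus, <- !RtoC_mult,
      <- RtoC_plus, <- RtoC_mult; reflexivity. }
assert (Hle := is_integral_0_oo_le f g _ _ Hf Hg).
assert (Hfg : forall x, 0 < x -> Cmod (f x) <= g x).
{ intros x Hx; unfold f; rewrite Cmod_mult.
  set (w := exp (- x) * x ^ k).
  assert (Hw : 0 < w).
  { apply Rmult_lt_0_compat; [apply exp_pos | apply pow_lt, Hx]. }
  rewrite Cmod_R, Rabs_pos_eq by lra.
  set (t := x / n).
  assert (Hxt : x = n * t) by (unfold t; field; lra).
  assert (Ht : 0 < t) by (apply Rdiv_lt_0_compat; auto).
  assert (E : (/ Rcpow n z * Rcpow x z)%C = Cexp (ln t * z)).
  { assert (Hx' : Rcpow x z = (Rcpow n z * Cexp (ln t * z))%C).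
    { unfold Rcpow; rewrite <- Cexp_plus, Hxt, ln_mult, RtoC_plus by auto.
      f_equal; ring. }
    rewrite Hx', Cmult_assoc, Cinv_l by apply Rcpow_neq_0; ring. }
  rewrite E.
  assert (B : Cmod (Cexp (ln t * z) - 1) <= c * Rabs (t - 1)).
  { apply Rle_trans with (1 := Cexp_real_increment z (ln t) Hz).
    apply Rmult_le_compat_l; auto.
    rewrite <- (exp_ln t) at 2 by auto; apply Rabs_exp_contract; lra. }
  (* AM-GM: 2 |t - 1| <= m (t - 1)^2 + 1 / m *)
  assert (A : Rabs (t - 1) <= (INR m * (t - 1) ^ 2 + / INR m) / 2).
  { rewrite <- (pow2_abs (t - 1)); set (u := Rabs (t - 1)).
    assert (A : 0 <= / INR m * (INR m * u - 1) ^ 2).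
    { apply Rmult_le_pos; [left; apply Rinv_0_lt_compat; auto|].
      apply pow2_ge_0. }
    replace (/ INR m * (INR m * u - 1) ^ 2)
      with (INR m * u ^ 2 + / INR m - 2 * u) in A by (field; lra); lra. }
  apply Rle_trans with (w * (c * ((INR m * (t - 1) ^ 2 + / INR m) / 2))).
  - apply Rmult_le_compat_l; [lra|].
    apply Rle_trans with (1 := B), Rmult_le_compat_l; auto.
  - right; unfold g.
    replace (exp (- x) * x ^ S (S k)) with (w * x ^ 2) by (unfold w; simpl; ring).
    replace (exp (- x) * x ^ S k) with (w * x) by (unfold w; simpl; ring).
    fold w; unfold t; field; lra. }
specialize (Hle Hfg).
replace (/ Rcpow n z * 0 - INR (fact k))%C with (- INR (fact k))%C in Hle by ring.
rewrite Cmod_opp, Cmod_R, Rabs_pos_eq in Hle by (left; apply INR_fact_lt_0).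
pose proof (INR_fact_lt_0 k) as Hfk.
rewrite (fact_simpl (S k)), (fact_simpl k), !mult_INR, (S_INR (S k)), <- Hn in Hle.
set (q := INR (fact k)) in *.
(* The variance term is m q / n = q / m, equal to the other term because n = m^2. *)
replace (c / 2 * (INR m * (/ n ^ 2 * ((n + 1) * (n * q)) - 2 / n * (n * q) + q)
  + / INR m * q)) with (c * q / INR m) in Hle by (unfold n; field; lra).
apply (Rmult_le_compat_r (INR m)) in Hle; [|lra].
unfold Rdiv in Hle; rewrite (Rmult_assoc (c * q)), Rinv_l in Hle by lra; nra.
Qed.

(** The functional equation lowers Re z by 1 until the strip is reached; the integer n bounding Re z
    serves as the induction measure. *)
Lemma Gamma_neq_0 (z : C) : 0 < Re z -> Gamma z <> 0.
Proof.
destruct (INR_unbounded (Re z)) as [n Hn]; revert z Hn.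
induction n as [|n IH]; intros z Hn Hz; [simpl in Hn; lra|].
destruct (Rle_dec (Re z) 1) as [H1|H1]; [apply Gamma_neq_0_strip; lra|].
replace z with (z - 1 + 1)%C by ring.
rewrite S_INR in Hn.
assert (Re (z - 1) = Re z - 1) by (rewrite re_minus, re_RtoC; reflexivity).
rewrite Gamma_plus_1 by lra.
apply Cmult_neq_0; [|apply IH; lra].
intros E; rewrite E, re_RtoC in *; lra.
Qed.

(** * The integrals defining zeta_N *)

(* The Mellin transform of phi M is regular on Re s > 0: subtracting e^-x
   times the leading singularity N! / x^N, with N = M + 1, cancels the pole of
   1 / (e^x - T_M) at 0 without spoiling the decay at infinity. *)
Definition phi (M : nat) (x : R) : R :=
  x ^ M / (exp x - T M x) - INR (fact (S M)) * exp (- x) / x.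

Lemma exp_minus_T_pos (M : nat) (x : R) : 0 < x -> 0 < exp x - T M x.
Proof.
intros Hx; destruct (exp_minus_T M x Hx) as [y [_ ->]].
apply Rmult_lt_0_compat; [|apply exp_pos].
apply Rdiv_lt_0_compat; [apply pow_lt, Hx | apply INR_fact_lt_0].
Qed.

(** Lagrange's remainder turns [phi M x] into (M+1)! (e^-y - e^-x) / x with 0 < y < x, and 1 - e^-x
    <= x. *)
Lemma phi_bounds (M : nat) (x : R) : 0 < x -> 0 <= phi M x <= INR (fact (S M)).
Proof.
intros Hx; unfold phi.
destruct (exp_minus_T M x Hx) as [y [Hy ->]].
pose proof (INR_fact_lt_0 (S M)) as Hf.
pose proof (pow_lt x M Hx).
replace (x ^ M / (x ^ S M / INR (fact (S M)) * exp y)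
  - INR (fact (S M)) * exp (- x) / x)
  with (INR (fact (S M)) * ((exp (- y) - exp (- x)) / x)).
2:{ rewrite (exp_Ropp y); simpl pow; field.
    pose proof (exp_pos y); repeat split; lra. }
assert (H1 : exp (- x) <= exp (- y)) by (apply exp_le; lra).
assert (H2 : exp (- y) <= 1) by (rewrite <- exp_0; apply exp_le; lra).
pose proof (exp_ineq1_le (- x)).
assert (H3 : 0 <= (exp (- y) - exp (- x)) / x <= 1).
{ split; [apply Rle_mult_inv_pos; lra|].
  apply Rmult_le_reg_r with x; auto; unfold Rdiv.
  rewrite Rmult_assoc, Rinv_l; lra. }
nra.
Qed.

(** One positive term of the exponential series beyond degree M is kept and the others are dropped.
    As its degree is arbitrary, 1 / (e^x - T_M) decays faster than any power. *)
Lemma T_plus_term_le_exp (M k : nat) (x : R) :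
  0 < x -> T M x + x ^ (M + S k) / INR (fact (M + S k)) <= exp x.
Proof.
intros Hx.
assert (Hterm : forall n, 0 <= x ^ n / INR (fact n)).
{ intros n; apply Rle_mult_inv_pos; [apply pow_le; lra | apply INR_fact_lt_0]. }
assert (Hmono : T M x <= T (M + k) x).
{ induction k as [|k IH]; [rewrite Nat.add_0_r; lra|].
  rewrite Nat.add_succ_r; unfold T in *; rewrite tech5.
  specialize (Hterm (S (M + k))); lra. }
pose proof (exp_minus_T_pos (M + S k) x Hx) as H.
rewrite Nat.add_succ_r in *; unfold T in *; rewrite tech5 in H; lra.
Qed.

(** The subtracted term of [phi] is nonnegative and can be discarded; the exponent is at least 1
    because exponent 0 is [phi_bounds]. *)
Lemma phi_decay (M k : nat) (x : R) :
  0 < x -> phi M x * x ^ S k <= INR (fact (M + S k)).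
Proof.
intros Hx.
pose proof (exp_minus_T_pos M x Hx) as HE.
pose proof (T_plus_term_le_exp M k x Hx) as H.
pose proof (INR_fact_lt_0 (M + S k)) as Hf.
pose proof (pow_lt x (S k) Hx) as Hk.
assert (Hp : phi M x <= x ^ M / (exp x - T M x)).
{ unfold phi; assert (0 <= INR (fact (S M)) * exp (- x) / x); [|lra].
  apply Rle_mult_inv_pos; auto.
  apply Rmult_le_pos; [apply pos_INR | left; apply exp_pos]. }
apply Rle_trans with (x ^ M / (exp x - T M x) * x ^ S k).
{ apply Rmult_le_compat_r; lra. }
replace (x ^ M / (exp x - T M x) * x ^ S k)
  with (x ^ (M + S k) / (exp x - T M x)) by (rewrite pow_add; field; lra).
apply Rmult_le_reg_r with (exp x - T M x); auto.
unfold Rdiv at 1; rewrite Rmult_assoc, Rinv_l, Rmult_1_r by lra.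
apply Rmult_le_reg_l with (/ INR (fact (M + S k))).
- apply Rinv_0_lt_compat, Hf.
- rewrite <- Rmult_assoc, Rinv_l, Rmult_1_l by lra.
  unfold Rdiv in H; lra.
Qed.

Lemma ex_derive_T (M : nat) (x : R) : ex_derive (T M) x.
Proof.
induction M as [|M IH].
- apply (ex_derive_ext (fun _ => 1)); [|auto_derive; auto].
  intros t; unfold T; simpl; field.
- apply (ex_derive_ext (fun t => T M t + t ^ S M / INR (fact (S M)))).
  + intros t; reflexivity.
  + auto_derive; auto.
Qed.

Lemma phi_rapidly_decreasing (M : nat) :
  rapidly_decreasing (fun x => RtoC (phi M x)).
Proof.
split.
- intros x Hx; apply RC_continuous_RtoC.
  apply (ex_derive_continuous (K := R_AbsRing) (V := R_NormedModule)).
  unfold phi; pose proof (exp_minus_T_pos M x Hx).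
  pose proof (ex_derive_T M x).
  auto_derive; repeat split; auto; lra.
- intros [|k].
  + exists (INR (fact (S M))); intros x Hx.
    destruct (phi_bounds M x Hx).
    rewrite Cmod_R, Rabs_pos_eq; simpl pow; lra.
  + exists (INR (fact (M + S k))); intros x Hx.
    destruct (phi_bounds M x Hx).
    rewrite Cmod_R, Rabs_pos_eq by lra; apply phi_decay, Hx.
Qed.

Lemma is_integral_exp_minus_1 (s : C) :
  0 < Re s < 1 ->
  is_integral_0_oo (fun x => (exp (- x) - 1) * Rcpow x (s - 2))%C
    (/ (s - 1) * Gamma s).
Proof.
intros Hs.
assert (Hs1 : (s - 1)%C <> 0).
{ intros E; apply (f_equal Re) in E; rewrite re_minus, !re_RtoC in E; lra. }
set (F := fun x : R => ((exp (- x) - 1) * Rcpow x (s - 1))%C).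
set (f := fun x : R => (- exp (- x) * Rcpow x (s - 1)
  + (exp (- x) - 1) * ((s - 1) * Rcpow x (s - 1 - 1)))%C).
(* [F] is at most x^(Re s) near 0, since 1 - e^-x <= x, and at most x^(Re s - 1) at infinity. Both
   ends decay exactly because s lies in the strip. *)
set (al := Rmin (Re s) (1 - Re s)).
assert (Hal : 0 < al) by (apply Rmin_pos; lra).
destruct (Cmod_exp_ln_vanishes F al 1 Hal) as [H0 Hoo].
{ intros x Hx; unfold F; rewrite Cmod_mult, Cmod_Rcpow, re_minus, re_RtoC.
  rewrite <- RtoC_minus, Cmod_R.
  pose proof (exp_ineq1_le (- x)); pose proof (exp_pos (- x)).
  assert (exp (- x) <= 1) by (rewrite <- exp_0; apply exp_le; lra).
  rewrite Rabs_left1, Rmult_1_l by lra.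
  pose proof (Rmin_l (Re s) (1 - Re s)) as A1; fold al in A1.
  pose proof (Rmin_r (Re s) (1 - Re s)) as A2; fold al in A2.
  pose proof (exp_pos ((Re s - 1) * ln x)).
  destruct (Rle_dec (ln x) 0) as [HL|HL].
  - rewrite Rabs_left1 by auto.
    apply Rle_trans with (x * exp ((Re s - 1) * ln x)).
    + apply Rmult_le_compat_r; lra.
    + rewrite <- (exp_ln x) at 1 by auto.
      rewrite <- exp_plus; apply exp_le; nra.
  - rewrite Rabs_pos_eq by lra.
    apply Rle_trans with (1 * exp ((Re s - 1) * ln x)).
    + apply Rmult_le_compat_r; lra.
    + rewrite Rmult_1_l; apply exp_le; nra. }
assert (H : is_integral_0_oo f (0 - 0)).
{ apply (is_integral_0_oo_derive F f 0 0); auto.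
  - intros x Hx; apply (is_RCderive_mult (fun x => exp (- x) - 1)%C
      (fun x => Rcpow x (s - 1))); [|apply is_RCderive_Rcpow, Hx].
    apply is_RCderive_pair; simpl; auto_derive; auto; ring.
  - intros x Hx.
    pose proof (proj1 exp_neg_rapidly_decreasing x Hx) as Hexp.
    unfold f; apply RC_continuous_plus; apply RC_continuous_mult.
    + apply (continuous_opp (V := C_R_NormedModule)), Hexp.
    + apply RC_continuous_Rcpow, Hx.
    + apply RC_continuous_minus; [exact Hexp | apply RC_continuous_const].
    + apply RC_continuous_mult; [apply RC_continuous_const|].
      apply RC_continuous_Rcpow, Hx. }
(* Adding e^-x x^(s-1) to [f] = F' leaves (s-1) (e^-x - 1) x^(s-2). *)
eapply is_integral_0_oo_ext; cycle 1.
- replace (Gamma s) with ((0 - 0) + Gamma s)%C by ring.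
  apply is_integral_0_oo_Cmult, is_integral_0_oo_plus; [exact H|].
  apply is_integral_Gamma; lra.
- intros x Hx; unfold f; cbv beta.
  replace (s - 1 - 1)%C with (s - 2)%C by ring; field; exact Hs1.
Qed.

Section ZetaIntegrals.

Variable M : nat.

Let E (x : R) : R := exp x - T M x.

Lemma zeta_integrand_decomposition (s : C) (x : R) :
  0 < x ->
  (Rcpow x (s + INR (S M) - 2) / RtoC (E x))%C =
  (phi M x * Rcpow x (s - 1)
   + INR (fact (S M)) * (exp (- x) * Rcpow x (s - 2)))%C.
Proof.
intros Hx; pose proof (exp_minus_T_pos M x Hx) as HE.
replace (s + INR (S M) - 2)%C with (INR M + (s - 1))%C
  by (rewrite S_INR, RtoC_plus; ring).
rewrite Rcpow_plus, Rcpow_INR by auto.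
replace (s - 1)%C with (s - 2 + 1)%C by ring.
rewrite Rcpow_plus, Rcpow_1 by auto.
unfold phi; fold (E x); fold (E x) in HE.
rewrite RtoC_minus, !RtoC_div, RtoC_mult by lra.
field; split; intros H; apply RtoC_inj in H; lra.
Qed.

Lemma is_integral_zeta (s : C) :
  1 < Re s ->
  is_integral_0_oo (fun x => Rcpow x (s + INR (S M) - 2) / RtoC (E x))%C
    (mellin (fun x => RtoC (phi M x)) s
     + INR (fact (S M)) * Gamma (s - 1)).
Proof.
intros Hs; eapply is_integral_0_oo_ext; cycle 1.
- apply is_integral_0_oo_plus.
  + apply is_integral_mellin; [apply phi_rapidly_decreasing | lra].
  + apply is_integral_0_oo_Cmult, is_integral_Gamma.
    rewrite re_minus, re_RtoC; lra.
- intros x Hx; cbv beta; rewrite zeta_integrand_decomposition by auto.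
  replace (s - 1 - 1)%C with (s - 2)%C by ring; reflexivity.
Qed.

(** Subtracting N!/x^N in place of N! e^-x / x^N changes the correction to [phi] from N! e^-x / x to
    N! (e^-x - 1) / x, whose Mellin integral converges in the strip. *)
Lemma is_integral_zeta_strip (s : C) :
  0 < Re s < 1 ->
  is_integral_0_oo
    (fun x => RtoC (1 / E x - INR (fact (S M)) / x ^ S M)
      * Rcpow x (s + INR (S M) - 2))%C
    (mellin (fun x => RtoC (phi M x)) s
     + INR (fact (S M)) * (/ (s - 1) * Gamma s)).
Proof.
intros Hs; eapply is_integral_0_oo_ext; cycle 1.
- apply is_integral_0_oo_plus.
  + apply is_integral_mellin; [apply phi_rapidly_decreasing | lra].
  + apply is_integral_0_oo_Cmult, is_integral_exp_minus_1, Hs.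
- intros x Hx; cbv beta.
  pose proof (exp_minus_T_pos M x Hx) as HE; fold (E x) in HE.
  pose proof (pow_lt x M Hx) as Hp.
  replace (s + INR (S M) - 2)%C with (INR M + (s - 1))%C
    by (rewrite S_INR, RtoC_plus; ring).
  rewrite Rcpow_plus, Rcpow_INR by auto.
  replace (s - 1)%C with (s - 2 + 1)%C by ring.
  rewrite Rcpow_plus, Rcpow_1 by auto.
  replace (1 / E x - INR (fact (S M)) / x ^ S M)
    with (1 / E x - INR (fact (S M)) / (x * x ^ M)) by reflexivity.
  unfold phi; fold (E x).
  rewrite !RtoC_minus, !RtoC_div, !RtoC_mult by nra.
  field; repeat split; intros H; apply RtoC_inj in H; lra.
Qed.

End ZetaIntegrals.

(** * Goursat's theorem *)

Definition horizontal_int (f : C -> C) (y a b : R) : C :=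
  RCInt (fun x => f (x, y)) a b.

Definition vertical_int (f : C -> C) (x c d : R) : C :=
  RCInt (fun y => f (x, y)) c d.

(** The boundary is run counterclockwise; [Ci] stands for dz = i dy on the vertical sides. *)
Definition rectangle_int (f : C -> C) (a b c d : R) : C :=
  (horizontal_int f c a b + Ci * vertical_int f b c d
   - horizontal_int f d a b - Ci * vertical_int f a c d)%C.

Definition Cderivable_on_rectangle (f : C -> C) (a b c d : R) : Prop :=
  forall x y, a <= x <= b -> c <= y <= d -> exists l, is_Cderive f (x, y) l.

Lemma RC_continuous_horizontal (f : C -> C) (x y : R) :
  CC_continuous f (x, y) -> RC_continuous (fun t => f (t, y)) x.
Proof.
intros H; apply (continuous_comp (U := R_UniformSpace) (V := C_UniformSpace)
  (W := C_UniformSpace) (fun t => (t, y))); [|exact H].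
apply RC_continuous_pair; simpl; [apply continuous_id | apply continuous_const].
Qed.

Lemma RC_continuous_vertical (f : C -> C) (x y : R) :
  CC_continuous f (x, y) -> RC_continuous (fun t => f (x, t)) y.
Proof.
intros H; apply (continuous_comp (U := R_UniformSpace) (V := C_UniformSpace)
  (W := C_UniformSpace) (fun t => (x, t))); [|exact H].
apply RC_continuous_pair; simpl; [apply continuous_const | apply continuous_id].
Qed.

Lemma RCInt_Chasles_continuous (g : R -> C) (a b c : R) :
  a <= b <= c -> (forall x, a <= x <= c -> RC_continuous g x) ->
  (RCInt g a b + RCInt g b c)%C = RCInt g a c.
Proof.
intros H Hg; apply (RInt_Chasles (V := C_R_CompleteNormedModule));
  apply (ex_RInt_continuous (V := C_R_CompleteNormedModule));
  intros x Hx; rewrite Rmin_left, Rmax_right in Hx by lra; apply Hg; lra.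
Qed.

Lemma Cderivable_on_rectangle_horizontal (f : C -> C) (a b c d x y : R) :
  Cderivable_on_rectangle f a b c d -> a <= x <= b -> c <= y <= d ->
  RC_continuous (fun t => f (t, y)) x.
Proof.
intros H Hx Hy; destruct (H x y Hx Hy) as [l Hl].
eapply RC_continuous_horizontal, is_Cderive_continuous, Hl.
Qed.

Lemma Cderivable_on_rectangle_vertical (f : C -> C) (a b c d x y : R) :
  Cderivable_on_rectangle f a b c d -> a <= x <= b -> c <= y <= d ->
  RC_continuous (fun t => f (x, t)) y.
Proof.
intros H Hx Hy; destruct (H x y Hx Hy) as [l Hl].
eapply RC_continuous_vertical, is_Cderive_continuous, Hl.
Qed.

(** Each inner edge is traversed twice in opposite directions. *)
Lemma rectangle_int_split (f : C -> C) (a m b c k d : R) :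
  a <= m <= b -> c <= k <= d -> Cderivable_on_rectangle f a b c d ->
  rectangle_int f a b c d =
  (rectangle_int f a m c k + rectangle_int f m b c k
   + rectangle_int f a m k d + rectangle_int f m b k d)%C.
Proof.
intros Hm Hk Hf; unfold rectangle_int, horizontal_int, vertical_int.
rewrite <- (RCInt_Chasles_continuous (fun x => f (x, c)) a m b);
  [| auto | intros; apply (Cderivable_on_rectangle_horizontal f a b c d);
            auto; lra].
rewrite <- (RCInt_Chasles_continuous (fun x => f (x, d)) a m b);
  [| auto | intros; apply (Cderivable_on_rectangle_horizontal f a b c d);
            auto; lra].
rewrite <- (RCInt_Chasles_continuous (fun y => f (a, y)) c k d);
  [| auto | intros; apply (Cderivable_on_rectangle_vertical f a b c d);
            auto; lra].
rewrite <- (RCInt_Chasles_continuous (fun y => f (b, y)) c k d);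
  [| auto | intros; apply (Cderivable_on_rectangle_vertical f a b c d);
            auto; lra].
ring.
Qed.

Lemma RCInt_minus_primitive_le (g p q : R -> C) (a b m : R) :
  a <= b ->
  (forall x, a <= x <= b -> RC_continuous g x) ->
  (forall x, is_RCderive p x (q x)) ->
  (forall x, RC_continuous q x) ->
  (forall x, a <= x <= b -> Cmod (g x - q x) <= m) ->
  Cmod (RCInt g a b - (p b - p a)) <= (b - a) * m.
Proof.
intros Hab Hg Hp Hq Hm.
assert (H : is_RInt (V := C_R_NormedModule)
  (fun x => minus (G := C_R_NormedModule) (g x) (q x)) a b
  (minus (G := C_R_NormedModule) (RCInt g a b)
    (minus (G := C_R_NormedModule) (p b) (p a)))).
{ apply (is_RInt_minus (V := C_R_NormedModule)).
  - apply is_RCInt; rewrite Rmin_left, Rmax_right by auto; exact Hg.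
  - apply (is_RInt_derive (V := C_R_CompleteNormedModule));
      intros x _; [apply Hp | apply Hq]. }
rewrite <- norm_C_R.
refine (norm_RInt_le_const _ a b _ m Hab _ H).
intros x Hx; rewrite norm_C_R; apply Hm, Hx.
Qed.

(** The affine approximation [q] of f at p has a primitive [P], so it contributes nothing to the
    closed integral; what remains is at most m along a perimeter of length 2 (b - a + d - c). *)
Lemma rectangle_int_le (f : C -> C) (a b c d : R) (p l : C) (m : R) :
  a <= b -> c <= d -> Cderivable_on_rectangle f a b c d ->
  (forall x y, a <= x <= b -> c <= y <= d ->
    Cmod (f (x, y) - f p - ((x, y) - p) * l) <= m) ->
  Cmod (rectangle_int f a b c d) <= 2 * (b - a + (d - c)) * m.
Proof.
intros Hab Hcd Hf Hm.
set (q := fun z : C => (f p + (z - p) * l)%C).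
set (P := fun z : C => (f p * z + (z * z / 2 - p * z) * l)%C).
assert (HPh : forall x y, is_RCderive (fun t => P (t, y)) x (q (x, y))).
{ intros x y; unfold P, q; generalize (f p); intros [A B].
  destruct p as [p1 p2], l as [l1 l2].
  apply is_RCderive_pair; simpl; auto_derive; auto; field. }
(* Vertically dP/dy = i q, so the primitive in y is -i P. *)
assert (HPv : forall x y, is_RCderive (fun t => - Ci * P (x, t))%C y (q (x, y))).
{ intros x y; unfold P, q; generalize (f p); intros [A B].
  destruct p as [p1 p2], l as [l1 l2].
  apply is_RCderive_pair; simpl; auto_derive; auto; field. }
assert (Hq : forall z, CC_continuous q z).
{ intros z; eapply is_Cderive_continuous.
  apply (is_Cderive_plus (fun _ => f p) (fun z => (z - p) * l)%C).
  - apply is_Cderive_const.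
  - apply (is_Cderive_mult (fun z => z - p)%C (fun _ => l)).
    + apply (is_Cderive_minus (fun z => z) (fun _ => p));
        [apply is_Cderive_id | apply is_Cderive_const].
    + apply is_Cderive_const. }
assert (Hmq : forall x y, a <= x <= b -> c <= y <= d ->
  Cmod (f (x, y) - q (x, y)) <= m).
{ intros x y Hx Hy; unfold q.
  replace (f (x, y) - (f p + ((x, y) - p) * l))%C
    with (f (x, y) - f p - ((x, y) - p) * l)%C by ring; auto. }
assert (HH : forall y, c <= y <= d ->
  Cmod (horizontal_int f y a b - (P (b, y) - P (a, y))) <= (b - a) * m).
{ intros y Hy.
  apply (RCInt_minus_primitive_le (fun x => f (x, y)) (fun x => P (x, y))
    (fun x => q (x, y))); auto.
  - intros x Hx; apply (Cderivable_on_rectangle_horizontal f a b c d); auto.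
  - intros x; apply RC_continuous_horizontal, Hq. }
assert (HV : forall x, a <= x <= b ->
  Cmod (vertical_int f x c d - (- Ci * P (x, d) - - Ci * P (x, c)))
    <= (d - c) * m).
{ intros x Hx.
  apply (RCInt_minus_primitive_le (fun y => f (x, y))
    (fun y => - Ci * P (x, y))%C (fun y => q (x, y))); auto.
  - intros y Hy; apply (Cderivable_on_rectangle_vertical f a b c d); auto.
  - intros y; apply RC_continuous_vertical, Hq. }
set (h1 := (horizontal_int f c a b - (P (b, c) - P (a, c)))%C).
set (h2 := (horizontal_int f d a b - (P (b, d) - P (a, d)))%C).
set (v1 := (vertical_int f b c d - (- Ci * P (b, d) - - Ci * P (b, c)))%C).
set (v2 := (vertical_int f a c d - (- Ci * P (a, d) - - Ci * P (a, c)))%C).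
assert (Hi : (Ci * Ci)%C = (- (1))%C) by (apply C_eq; simpl; ring).
replace (rectangle_int f a b c d) with (h1 + Ci * v1 + - h2 + - (Ci * v2))%C.
2:{ unfold rectangle_int, h1, h2, v1, v2.
    generalize (P (b, d)) (P (b, c)) (P (a, d)) (P (a, c)).
    intros Pbd Pbc Pad Pac.
    (* The corner values of [P] are collected under the factor 1 + i^2, which vanishes. *)
    transitivity (horizontal_int f c a b + Ci * vertical_int f b c d -
      horizontal_int f d a b - Ci * vertical_int f a c d
      + (1 + Ci * Ci) * (Pbd - Pbc - Pad + Pac))%C; [ring|].
    rewrite Hi; ring. }
assert (Hh1 : Cmod h1 <= (b - a) * m) by (apply HH; lra).
assert (Hh2 : Cmod h2 <= (b - a) * m) by (apply HH; lra).
assert (Hv1 : Cmod v1 <= (d - c) * m) by (apply HV; lra).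
assert (Hv2 : Cmod v2 <= (d - c) * m) by (apply HV; lra).
apply Rle_trans with (1 := Cmod_triangle _ _).
rewrite Cmod_opp, Cmod_mult, Cmod_Ci, Rmult_1_l.
pose proof (Cmod_triangle (h1 + Ci * v1) (- h2)) as T1.
pose proof (Cmod_triangle h1 (Ci * v1)) as T2.
rewrite Cmod_opp in T1; rewrite Cmod_mult, Cmod_Ci, Rmult_1_l in T2.
lra.
Qed.

Lemma nested_intervals (u v : nat -> R) :
  (forall n, u n <= u (S n)) -> (forall n, v (S n) <= v n) ->
  (forall n, u n <= v n) -> exists x, forall n, u n <= x <= v n.
Proof.
intros Hu Hv Huv.
assert (Hu' : forall n k, u n <= u (n + k)%nat).
{ intros n k; induction k as [|k IH]; [rewrite Nat.add_0_r; lra|].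
  rewrite Nat.add_succ_r; specialize (Hu (n + k)%nat); lra. }
assert (Hv' : forall n k, v (n + k)%nat <= v n).
{ intros n k; induction k as [|k IH]; [rewrite Nat.add_0_r; lra|].
  rewrite Nat.add_succ_r; specialize (Hv (n + k)%nat); lra. }
assert (H : forall m n, u m <= v n).
{ intros m n; specialize (Hu' m n); specialize (Hv' n m).
  rewrite Nat.add_comm in Hv'; specialize (Huv (m + n)%nat); lra. }
destruct (completeness (fun x => exists n, x = u n)) as [x [Hx1 Hx2]].
- exists (v 0%nat); intros x [n ->]; apply H.
- exists (u 0%nat); exists 0%nat; reflexivity.
- exists x; intros n; split.
  + apply Hx1; exists n; reflexivity.
  + apply Hx2; intros y [m ->]; apply H.
Qed.

Section Goursat.

Variables (f : C -> C) (a b c d : R).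
Hypothesis Hab : a <= b.
Hypothesis Hcd : c <= d.
Hypothesis Hf : Cderivable_on_rectangle f a b c d.

Let w n := (b - a) / 2 ^ n.
Let h n := (d - c) / 2 ^ n.

(** A rectangle of level n is coded by its lower left corner z, its sides being fixed as [w n] and
    [h n]. *)
Let inside n (z : C) : Prop :=
  (a <= fst z /\ fst z + w n <= b) /\ (c <= snd z /\ snd z + h n <= d).

Let I n (z : C) : C :=
  rectangle_int f (fst z) (fst z + w n) (snd z) (snd z + h n).

Let refines n (z z' : C) : Prop :=
  (fst z <= fst z' /\ fst z' + w (S n) <= fst z + w n) /\
  (snd z <= snd z' /\ snd z' + h (S n) <= snd z + h n).

Lemma half_width n : w n = w (S n) + w (S n) /\ 0 <= w n.
Proof.
pose proof (pow_lt 2 n Rlt_0_2); unfold w; simpl; split; [field; lra|].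
apply Rle_mult_inv_pos; lra.
Qed.

Lemma half_height n : h n = h (S n) + h (S n) /\ 0 <= h n.
Proof.
pose proof (pow_lt 2 n Rlt_0_2); unfold h; simpl; split; [field; lra|].
apply Rle_mult_inv_pos; lra.
Qed.

Lemma inside_Cderivable n z :
  inside n z ->
  Cderivable_on_rectangle f (fst z) (fst z + w n) (snd z) (snd z + h n).
Proof.
intros [Hx Hy] x y Hx' Hy'; apply Hf; lra.
Qed.

Lemma bisection_step n z (e : R) :
  inside n z -> e <= Cmod (I n z) ->
  exists z', refines n z z' /\ inside (S n) z' /\ e / 4 <= Cmod (I (S n) z').
Proof.
intros Hz He; pose proof (inside_Cderivable n z Hz) as Hd.
destruct z as [x y]; unfold inside, refines, I in *; simpl fst in *; simpl snd in *.
destruct (half_width n) as [Hw Hw0]; destruct (half_height n) as [Hh Hh0].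
set (w' := w (S n)) in *; set (h' := h (S n)) in *.
rewrite (rectangle_int_split f x (x + w') (x + w n) y (y + h') (y + h n)) in He
  by (auto; lra).
replace (x + w n) with (x + w' + w') in He by lra.
replace (y + h n) with (y + h' + h') in He by lra.
set (r1 := rectangle_int f x (x + w') y (y + h')) in *.
set (r2 := rectangle_int f (x + w') (x + w' + w') y (y + h')) in *.
set (r3 := rectangle_int f x (x + w') (y + h') (y + h' + h')) in *.
set (r4 := rectangle_int f (x + w') (x + w' + w') (y + h') (y + h' + h')) in *.
pose proof (Cmod_triangle (r1 + r2 + r3) r4) as T1.
pose proof (Cmod_triangle (r1 + r2) r3) as T2.
pose proof (Cmod_triangle r1 r2) as T3.
destruct (Rle_dec (e / 4) (Cmod r1)) as [H1|H1];
  [exists (x, y); simpl; repeat split; try lra; exact H1|].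
destruct (Rle_dec (e / 4) (Cmod r2)) as [H2|H2];
  [exists (x + w', y); simpl; repeat split; try lra; exact H2|].
destruct (Rle_dec (e / 4) (Cmod r3)) as [H3|H3];
  [exists (x, y + h'); simpl; repeat split; try lra; exact H3|].
exists (x + w', y + h'); simpl; repeat split; try lra; change (e / 4 <= Cmod r4); lra.
Qed.

Lemma bisection_sequence (e : R) :
  e <= Cmod (rectangle_int f a b c d) ->
  exists u : nat -> C, forall n,
    inside n (u n) /\ e / 4 ^ n <= Cmod (I n (u n)) /\ refines n (u n) (u (S n)).
Proof.
intros He.
set (good n z := inside n z /\ e / 4 ^ n <= Cmod (I n z)).
assert (step : forall n z, exists z',
  good n z -> good (S n) z' /\ refines n z z').
(* The step is made total, with a dummy value at bad corners, so that choice yields a function to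
   iterate. *)
{ intros n z; destruct (classic (good n z)) as [[H1 H2]|H]; [|exists z; tauto].
  destruct (bisection_step n z _ H1 H2) as [z' [A [B D]]].
  exists z'; intros _; split; auto; split; auto.
  replace (e / 4 ^ S n) with (e / 4 ^ n / 4); auto.
  simpl; field; pose proof (pow_lt 4 n); lra. }
set (g n z := proj1_sig (constructive_indefinite_description _ (step n z))).
assert (Hg : forall n z, good n z -> good (S n) (g n z) /\ refines n z (g n z)).
{ intros n z; exact (proj2_sig (constructive_indefinite_description _ (step n z))). }
set (u := fix u n := match n with O => (a, c) | S m => g m (u m) end).
assert (Hu : forall n, good n (u n)).
{ induction n as [|n IH]; [|apply (Hg n _ IH)].
  unfold good, inside, I, w, h; simpl.
  replace (a + (b - a) / 1) with b by field.
  replace (c + (d - c) / 1) with d by field.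
  repeat split; try lra; unfold Rdiv; rewrite Rinv_1; lra. }
exists u; intros n; destruct (Hu n) as [A B].
split; [exact A | split; [exact B | exact (proj2 (Hg n (u n) (Hu n)))]].
Qed.

Lemma Goursat : rectangle_int f a b c d = 0.
Proof.
destruct (Ceq_dec (rectangle_int f a b c d) 0) as [H|H]; auto; exfalso.
apply Cmod_gt_0 in H; set (e := Cmod (rectangle_int f a b c d)) in *.
destruct (bisection_sequence e (Rle_refl _)) as [u Hu].
destruct (nested_intervals (fun n => fst (u n)) (fun n => fst (u n) + w n))
  as [x Hx].
{ intros n; apply (Hu n). }
{ intros n; apply (Hu n). }
{ intros n; destruct (half_width n); lra. }
destruct (nested_intervals (fun n => snd (u n)) (fun n => snd (u n) + h n))
  as [y Hy].
{ intros n; apply (Hu n). }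
{ intros n; apply (Hu n). }
{ intros n; destruct (half_height n); lra. }
assert (Hxy : a <= x <= b /\ c <= y <= d).
{ destruct (Hu 0%nat) as [[K1 K2] _]; specialize (Hx 0%nat).
  specialize (Hy 0%nat); lra. }
destruct (Hf x y) as [l Hl]; try tauto.
set (D := b - a + (d - c)).
assert (HD : 0 <= D) by (unfold D; lra).
(* At level n the half-perimeter is D / 2^n, so the integral is at most 2 eta D^2 / 4^n, while
   bisection keeps it at least e / 4^n. This [eta] makes 2 eta D^2 < e, even if D = 0. *)
set (eta := e / (2 * D ^ 2 + 1)).
assert (HD2 := pow2_ge_0 D).
assert (Heta : 0 < eta) by (apply Rdiv_lt_0_compat; lra).
assert (Heta' : eta * (2 * D ^ 2 + 1) = e) by (unfold eta; field; lra).
destruct (proj1 (is_Cderive_iff f (x, y) l) Hl eta Heta) as [del [Hdel Hlim]].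
assert (Hn : exists n, D / 2 ^ n < del).
{ destruct (pow_lt_1_zero (/ 2)) with (y := del / (D + 1)) as [n Hn].
  - rewrite Rabs_pos_eq; lra.
  - apply Rdiv_lt_0_compat; lra.
  - exists n; specialize (Hn n (le_n n)).
    assert (H2n := pow_lt 2 n Rlt_0_2).
    rewrite pow_inv, Rabs_pos_eq in Hn
      by (left; apply Rinv_0_lt_compat; auto).
    apply (Rmult_lt_compat_r (D + 1)) in Hn; [|lra].
    unfold Rdiv in Hn; rewrite (Rmult_assoc del), Rinv_l in Hn by lra.
    assert (0 < / 2 ^ n) by (apply Rinv_0_lt_compat; auto).
    unfold Rdiv; nra. }
destruct Hn as [n Hn].
destruct (Hu n) as [Hin [HI _]]; specialize (Hx n); specialize (Hy n).
destruct (half_width n) as [_ Hw]; destruct (half_height n) as [_ Hh].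
assert (H2n := pow_lt 2 n Rlt_0_2).
assert (HDn : w n + h n = D / 2 ^ n) by (unfold w, h, D; field; lra).
assert (HB : Cmod (I n (u n)) <= 2 * (w n + h n) * (eta * (w n + h n))).
{ unfold I.
  replace (2 * (w n + h n)) with (2 * (fst (u n) + w n - fst (u n)
    + (snd (u n) + h n - snd (u n)))) by ring.
  apply (rectangle_int_le f _ _ _ _ (x, y) l); try lra.
  - apply inside_Cderivable, Hin.
  - intros x' y' Hx' Hy'.
    assert (Hc : Cmod ((x', y') - (x, y)) <= w n + h n).
    { apply Rle_trans with (1 := Cmod_le_abs _); simpl.
      apply Rplus_le_compat; apply Rabs_le; lra. }
    apply Rle_trans with (eta * Cmod ((x', y') - (x, y))).
    + apply Hlim; lra.
    + apply Rmult_le_compat_l; lra. }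
assert (H4n := pow_lt 4 n ltac:(lra)).
assert (H42 : 4 ^ n = 2 ^ n * 2 ^ n).
{ rewrite <- Rpow_mult_distr; f_equal; ring. }
rewrite HDn in HB.
assert (K : e / 4 ^ n <= 2 * (D / 2 ^ n) * (eta * (D / 2 ^ n))) by lra.
apply (Rmult_le_compat_r (4 ^ n)) in K; [|lra].
replace (2 * (D / 2 ^ n) * (eta * (D / 2 ^ n)) * 4 ^ n) with (2 * eta * D ^ 2) in K
  by (rewrite H42; field; lra).
unfold Rdiv in K; rewrite Rmult_assoc, Rinv_l in K by lra.
nra.
Qed.

End Goursat.

(** * Identity theorem on a disc *)

Lemma is_RInt_continuous (g : R -> R) (a b : R) :
  (forall x, continuous g x) -> is_RInt g a b (RInt g a b).
Proof.
intros H; apply (RInt_correct (V := R_CompleteNormedModule)).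
apply (ex_RInt_continuous (V := R_CompleteNormedModule)); auto.
Qed.

Lemma is_RInt_RtoC (g : R -> R) (a b l : R) :
  is_RInt g a b l ->
  is_RInt (V := C_R_NormedModule) (fun x => RtoC (g x)) a b (RtoC l).
Proof.
intros H.
apply (is_RInt_fct_extend_pair (U := R_NormedModule) (V := R_NormedModule)
  (fun x => RtoC (g x)) a b l 0); simpl; [exact H|].
pose proof (is_RInt_const (V := R_NormedModule) a b 0) as H0.
unfold scal in H0; simpl in H0; unfold mult in H0; simpl in H0.
rewrite Rmult_0_r in H0; exact H0.
Qed.

Section Peak.

Let k (n : nat) (y : R) : R := exp (INR n * (2 * cos y)).

Lemma continuous_peak n y : continuous (k n) y.
Proof.
apply (ex_derive_continuous (K := R_AbsRing) (V := R_NormedModule)).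
unfold k; auto_derive; auto.
Qed.

(** Only the window |y| <= r/2, of length r, is kept; half of r is left as a margin against the
    values of the kernel outside |y| < r. *)
Lemma peak_integral_ge (n : nat) (r : R) :
  0 < r <= PI -> r * exp (INR n * (2 * cos (r / 2))) <= RInt (k n) (- PI) PI.
Proof.
intros Hr.
assert (Hex : forall a b, ex_RInt (V := R_NormedModule) (k n) a b).
{ intros a b; eexists; apply is_RInt_continuous, continuous_peak. }
assert (Hpos : forall a b, a <= b -> 0 <= RInt (k n) a b).
{ intros a b Hab; apply RInt_ge_0; auto; intros; left; apply exp_pos. }
rewrite <- (RInt_Chasles (k n) (- PI) (- (r / 2)) PI) by auto.
rewrite <- (RInt_Chasles (k n) (- (r / 2)) (r / 2) PI) by auto.
unfold plus; simpl.
pose proof (Hpos (- PI) (- (r / 2)) ltac:(lra)).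
pose proof (Hpos (r / 2) PI ltac:(lra)).
assert (H1 : RInt (fun _ => exp (INR n * (2 * cos (r / 2)))) (- (r / 2)) (r / 2)
  <= RInt (k n) (- (r / 2)) (r / 2)).
{ apply RInt_le; auto; [lra | apply ex_RInt_const |].
  intros y Hy; apply exp_le, Rmult_le_compat_l; [apply pos_INR|].
  apply Rmult_le_compat_l; [lra|].
  destruct (Rle_dec 0 y).
  - apply cos_decr_1; lra.
  - rewrite <- (cos_neg y); apply cos_decr_1; lra. }
rewrite RInt_const in H1; unfold scal in H1; simpl in H1; unfold mult in H1;
  simpl in H1.
replace (r / 2 - - (r / 2)) with r in H1 by field; lra.
Qed.

(** Laplace's method. If g(0) is not 0, replacing g by g(0) costs at most half of |g(0)| times the
    total mass near the peak, and a term of order e^(2n cos r) away from it. The mass is at least r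
    e^(2n cos(r/2)), which eventually outgrows that term. *)
Lemma peak_vanishing (g : R -> C) :
  (forall y, RC_continuous g y) ->
  (forall n : nat,
    RCInt (fun y => g y * exp (INR n * (2 * cos y)))%C (- PI) PI = 0) ->
  g 0 = 0.
Proof.
intros Hg H0.
destruct (Ceq_dec (g 0) 0) as [|HA]; auto; exfalso.
apply Cmod_gt_0 in HA; set (A := Cmod (g 0)) in *.
assert (HPI := PI_RGT_0).
set (d y := (g y - g 0)%C).
assert (Hd : forall y, RC_continuous d y).
{ intros y; apply RC_continuous_minus; [apply Hg | apply RC_continuous_const]. }
destruct (proj1 (RC_continuous_iff g 0) (Hg 0) (A / 2)) as [r0 [Hr0 Hr]];
  [lra|].
set (r := Rmin r0 PI).
assert (Hr1 : 0 < r <= PI) by (split; [apply Rmin_pos; auto | apply Rmin_r]).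
destruct (continuity_ab_maj (fun y => Cmod (d y)) (- PI) PI) as [ym [Hym _]];
  [lra | intros y _; apply continuity_pt_filterlim, continuous_Cmod, Hd |].
set (m := Cmod (d ym)) in *.
assert (Hm : 0 <= m) by apply Cmod_ge_0.
set (s := 2 * cos (r / 2) - 2 * cos r).
assert (Hs : 0 < s).
{ unfold s; assert (cos r < cos (r / 2)) by (apply cos_decreasing_1; lra); lra. }
(* The mass exceeds the off-peak value by the factor r e^(n s). The linear bound e^(n s) >= n s
   suffices, and this n makes (A/2) r n s > 2 pi m. *)
destruct (INR_unbounded (2 * PI * m / (A / 2 * r * s))) as [n Hn].
assert (Hars : 0 < A / 2 * r * s) by (repeat apply Rmult_lt_0_compat; lra).
set (J := RInt (k n) (- PI) PI).
assert (HJ : is_RInt (V := R_NormedModule) (k n) (- PI) PI J)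
  by (apply is_RInt_continuous, continuous_peak).
assert (Hkc : forall y, RC_continuous (fun y => RtoC (k n y)) y)
  by (intros y; apply RC_continuous_RtoC, continuous_peak).
assert (HgJ : Cmod (g 0) * J <= A / 2 * J + (PI - - PI) * (m * exp (INR n * (2 * cos r)))).
{ assert (HI : is_RInt (V := C_R_NormedModule) (fun y => d y * k n y)%C
    (- PI) PI (- (g 0 * J))%C).
  { replace (- (g 0 * J))%C with (0 - g 0 * J)%C by ring.
    rewrite <- (H0 n).
    apply (is_RInt_ext (V := C_R_NormedModule) (fun y => minus (G := C_R_NormedModule)
      (g y * exp (INR n * (2 * cos y)))%C (g 0 * k n y)%C)).
    - intros y _; unfold d, k.
      change (g y * exp (INR n * (2 * cos y)) - g 0 * exp (INR n * (2 * cos y))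
        = (g y - g 0) * exp (INR n * (2 * cos y)))%C; ring.
    - apply (is_RInt_minus (V := C_R_NormedModule)).
      + apply is_RCInt; intros y _; apply RC_continuous_mult; [apply Hg | apply Hkc].
      + apply is_RInt_Cmult.
        apply is_RInt_RtoC, HJ. }
  rewrite <- (Rabs_pos_eq J), <- Cmod_R, <- Cmod_mult, <- Cmod_opp.
  2:{ apply RInt_ge_0; [lra | eexists; exact HJ | intros; left; apply exp_pos]. }
  rewrite <- norm_C_R, Cmod_R, (Rabs_pos_eq J).
  2:{ apply RInt_ge_0; [lra | eexists; exact HJ | intros; left; apply exp_pos]. }
  apply (norm_RInt_le (V := C_R_NormedModule) (fun y => d y * k n y)%C
    (fun y => A / 2 * k n y + m * exp (INR n * (2 * cos r))) (- PI) PI); auto; [lra| |].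
  - intros y Hy; rewrite norm_C_R, Cmod_mult, Cmod_R.
    pose proof (exp_pos (INR n * (2 * cos y))) as Hk; fold (k n y) in Hk.
    rewrite Rabs_pos_eq by lra.
    pose proof (exp_pos (INR n * (2 * cos r))) as Hkr.
    destruct (Rlt_dec (Rabs y) r) as [Hyr|Hyr].
    + assert (Cmod (d y) < A / 2).
      { apply Hr; rewrite Rminus_0_r; apply Rlt_le_trans with (1 := Hyr), Rmin_l. }
      assert (0 <= m * exp (INR n * (2 * cos r))) by (apply Rmult_le_pos; lra).
      nra.
    + assert (Hle : k n y <= exp (INR n * (2 * cos r))).
      { apply exp_le, Rmult_le_compat_l; [apply pos_INR|].
        apply Rmult_le_compat_l; [lra|].
        destruct (Rle_dec 0 y).
        - rewrite Rabs_pos_eq in Hyr by auto; apply cos_decr_1; lra.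
        - rewrite Rabs_left in Hyr by lra.
          rewrite <- (cos_neg y); apply cos_decr_1; lra. }
      assert (Cmod (d y) * k n y <= m * exp (INR n * (2 * cos r))).
      { apply Rmult_le_compat; auto; [apply Cmod_ge_0 | lra]. }
      assert (0 <= A / 2 * k n y) by (apply Rmult_le_pos; lra); lra.
  - apply (is_RInt_plus (V := R_NormedModule)).
    + apply (is_RInt_scal (V := R_NormedModule) (k n)), HJ.
    + apply (is_RInt_const (V := R_NormedModule)). }
fold A in HgJ.
pose proof (peak_integral_ge n r Hr1) as HJr; fold J in HJr.
assert (HE : exp (INR n * (2 * cos (r / 2)))
  = exp (INR n * s) * exp (INR n * (2 * cos r))).
{ rewrite <- exp_plus; f_equal; unfold s; ring. }
rewrite HE in HJr.
set (E := exp (INR n * (2 * cos r))) in *.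
assert (HE0 : 0 < E) by apply exp_pos.
pose proof (exp_ineq1_le (INR n * s)) as Hexp.
assert (K1 : A / 2 * (r * (INR n * s * E)) <= 2 * PI * (m * E)).
{ apply Rle_trans with (A / 2 * J); [|lra].
  apply Rmult_le_compat_l; [lra|].
  apply Rle_trans with (2 := HJr), Rmult_le_compat_l; [lra|].
  apply Rmult_le_compat_r; lra. }
assert (K2 : INR n * (A / 2 * r * s) <= 2 * PI * m).
{ apply Rmult_le_reg_r with E; auto; lra. }
apply (Rmult_lt_compat_r (A / 2 * r * s)) in Hn; auto.
unfold Rdiv at 1 in Hn; rewrite Rmult_assoc, Rinv_l in Hn by lra; lra.
Qed.

End Peak.

Lemma Cexp_vertical_period (x : R) : Cexp (x, - PI) = Cexp (x, PI).
Proof.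
unfold Cexp, Re, Im; simpl; rewrite cos_neg, sin_neg, sin_PI; f_equal; ring.
Qed.

Lemma Cexp_opp_vertical_period (x : R) : Cexp (- (x, - PI)) = Cexp (- (x, PI)).
Proof.
unfold Cexp, Re, Im; simpl; rewrite Ropp_involutive, cos_neg, sin_neg, sin_PI.
f_equal; ring.
Qed.

(* In the coordinate z = q + (w - q) e^v the disc becomes a half-plane and f a
   2 pi i-periodic function vanishing far to the left.  Goursat's theorem on
   [-L, 0] x [-pi, pi], applied to f times exp (n (e^v + e^-v)), leaves only
   the integral over the circle through w, where that factor is the kernel
   exp (2 n cos y) concentrating at w. *)
Lemma vanishes_on_disc (f : C -> C) (q : C) (rho eps : R) :
  0 < eps ->
  (forall z, Cmod (z - q) < rho -> exists l, is_Cderive f z l) ->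
  (forall z, Cmod (z - q) < eps -> f z = 0) ->
  forall w, Cmod (w - q) < rho -> f w = 0.
Proof.
intros Heps Hf H0 w Hw.
set (r := (w - q)%C) in *.
(* For w = q the exponential coordinate degenerates, but f(q) = 0 is given. *)
destruct (Ceq_dec r 0) as [Hr|Hr].
{ apply H0; fold r; rewrite Hr, Cmod_0; exact Heps. }
apply Cmod_gt_0 in Hr.
set (c := fun v : C => (q + r * Cexp v)%C).
assert (Hc : forall v, Cmod (c v - q) = Cmod r * exp (Re v)).
{ intros v; unfold c; replace (q + r * Cexp v - q)%C with (r * Cexp v)%C by ring.
  rewrite Cmod_mult, Cmod_Cexp; reflexivity. }
assert (Hcd : forall v, exists l, is_Cderive c v l).
{ intros v; eexists.
  apply (is_Cderive_plus (fun _ => q) (fun v => r * Cexp v)%C);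
    [apply is_Cderive_const|].
  apply (is_Cderive_mult (fun _ => r) Cexp);
    [apply is_Cderive_const | apply is_Cderive_Cexp]. }
assert (Hfc : forall v, Re v <= 0 -> exists l, is_Cderive (fun v => f (c v)) v l).
{ intros v Hv; destruct (Hcd v) as [l Hl].
  destruct (Hf (c v)) as [k Hk].
  - rewrite Hc; apply Rle_lt_trans with (2 := Hw).
    rewrite <- (Rmult_1_r (Cmod r)) at 2; apply Rmult_le_compat_l; [lra|].
    rewrite <- exp_0; apply exp_le, Hv.
  - eexists; apply (is_Cderive_comp f c); [exact Hk | exact Hl]. }
set (g := fun y : R => f (c (0, y))).
replace (f w) with (g 0).
2:{ unfold g, c; f_equal.
    replace (0%R, 0%R) with (RtoC 0) by reflexivity.
    rewrite Cexp_0; unfold r; ring. }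
apply peak_vanishing.
{ intros y; apply RC_continuous_vertical with (f := fun v => f (c v)).
  destruct (Hfc (0, y)) as [l Hl]; [simpl; lra|].
  eapply is_Cderive_continuous, Hl. }
intros n.
set (K := fun v : C => (INR n * (Cexp v + Cexp (- v)))%C).
assert (HKd : forall v, exists l, is_Cderive (fun v => Cexp (K v)) v l).
{ intros v; eexists; apply (is_Cderive_comp Cexp K); [apply is_Cderive_Cexp|].
  apply (is_Cderive_mult (fun _ => RtoC (INR n)) (fun v => Cexp v + Cexp (- v))%C);
    [apply is_Cderive_const|].
  apply is_Cderive_plus; [apply is_Cderive_Cexp|].
  apply (is_Cderive_comp Cexp (fun v => - v)%C); [apply is_Cderive_Cexp|].
  apply (is_derive_opp (V := AbsRing_NormedModule C_AbsRing) (fun v => v)).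
  apply is_Cderive_id. }
set (h := fun v : C => (f (c v) * Cexp (K v))%C).
(* Since e^L > L, the left side of the rectangle maps into the disc of radius eps, where f = 0. *)
set (L := Cmod r / eps).
assert (HL : 0 < L) by (apply Rdiv_lt_0_compat; auto).
assert (HLe : Cmod r * exp (- L) < eps).
{ pose proof (exp_ineq1_le L); rewrite exp_Ropp.
  apply Rmult_lt_reg_r with (exp L); [apply exp_pos|].
  rewrite Rmult_assoc, Rinv_l, Rmult_1_r by lra.
  replace (Cmod r) with (eps * L) by (unfold L; field; lra).
  apply Rmult_lt_compat_l; lra. }
assert (HG : rectangle_int h (- L) 0 (- PI) PI = 0).
{ pose proof PI_RGT_0; apply Goursat; try lra.
  intros x y Hx Hy; destruct (Hfc (x, y)) as [l Hl]; [simpl; lra|].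
  destruct (HKd (x, y)) as [l' Hl'].
  eexists; apply (is_Cderive_mult (fun v => f (c v)) (fun v => Cexp (K v)));
    [exact Hl | exact Hl']. }
assert (Hper : horizontal_int h (- PI) (- L) 0 = horizontal_int h PI (- L) 0).
{ apply (RInt_ext (V := C_R_CompleteNormedModule)); intros x _.
  unfold h, K, c; rewrite Cexp_vertical_period, Cexp_opp_vertical_period.
  reflexivity. }
assert (Hleft : vertical_int h (- L) (- PI) PI = 0).
{ unfold vertical_int, RCInt.
  rewrite (RInt_ext (V := C_R_CompleteNormedModule) _
    (fun _ => zero (G := C_R_NormedModule))).
  - rewrite (RInt_const (V := C_R_CompleteNormedModule)).
    apply (scal_zero_r (V := C_R_NormedModule)).
  - intros y _; unfold h; rewrite H0; [apply Cmult_0_l|].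
    rewrite Hc; exact HLe. }
unfold rectangle_int in HG; rewrite Hper, Hleft in HG.
assert (Hright : vertical_int h 0 (- PI) PI = 0).
{ replace (vertical_int h 0 (- PI) PI) with
    (/ Ci * (horizontal_int h PI (- L) 0 + Ci * vertical_int h 0 (- PI) PI
      - horizontal_int h PI (- L) 0 - Ci * 0))%C by (field; apply Ci_nz).
  rewrite HG; ring. }
(* On the imaginary axis e^v + e^-v = 2 cos y, which is the peak kernel. *)
rewrite <- Hright; apply (RInt_ext (V := C_R_CompleteNormedModule)).
intros y _; unfold g, h; f_equal; rewrite <- Cexp_RtoC; f_equal.
unfold K; apply C_eq; unfold Cexp; simpl; unfold Re, Im; simpl;
  rewrite ?Ropp_0, ?exp_0, ?cos_neg, ?sin_neg; ring.
Qed.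

(** * Analytic continuation along a segment *)

(** Connectedness of [0, 1], by a supremum. The local hypothesis carries S between any two points
    near t0, so no separate openness and closedness proofs are needed. *)
Lemma unit_interval_induction (S : R -> Prop) :
  S 0 ->
  (forall t0, 0 <= t0 <= 1 -> exists eta, 0 < eta /\
    forall t, 0 <= t <= 1 -> Rabs (t - t0) < eta -> S t ->
    forall u, 0 <= u <= 1 -> Rabs (u - t0) < eta -> S u) ->
  S 1.
Proof.
intros S0 Hloc.
set (E t := 0 <= t <= 1 /\ forall u, 0 <= u <= t -> S u).
assert (E0 : E 0).
{ split; [lra|]; intros u Hu; replace u with 0 by lra; exact S0. }
destruct (completeness E) as [T [HT1 HT2]].
{ exists 1; intros t [Ht _]; lra. }
{ exists 0; exact E0. }
assert (HT : 0 <= T <= 1).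
{ split; [apply HT1, E0 | apply HT2; intros t [Ht _]; lra]. }
destruct (Hloc T HT) as [eta [Heta H]].
assert (Ht : exists t, E t /\ T - eta < t).
{ apply NNPP; intros Hn.
  assert (T <= T - eta); [|lra].
  apply HT2; intros t Et; apply Rnot_lt_le; intros Hlt; apply Hn.
  exists t; auto. }
destruct Ht as [t [[Ht Et] Htn]].
assert (HtT : t <= T) by (apply HT1; split; auto).
assert (Hu : forall u, 0 <= u <= 1 -> u < T + eta -> S u).
{ intros u Hu HuT; destruct (Rle_dec u t) as [Hut|Hut]; [apply Et; lra|].
  apply (H t); auto.
  - apply Rabs_def1; lra.
  - apply Et; lra.
  - apply Rabs_def1; lra. }
destruct (Rlt_dec T 1) as [H1|H1]; [|apply Hu; lra].
set (t' := Rmin 1 (T + eta / 2)).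
assert (Ht' : T < t' /\ t' <= 1 /\ t' <= T + eta / 2).
{ unfold t'; split; [apply Rmin_glb_lt; lra|].
  split; [apply Rmin_l | apply Rmin_r]. }
assert (t' <= T); [|lra].
apply HT1; split; [lra|]; intros u Hu'; apply Hu; lra.
Qed.

Lemma Cmod_minus_sym (z w : C) : Cmod (z - w) = Cmod (w - z).
Proof. rewrite <- Cmod_opp; f_equal; ring. Qed.

Lemma Cmod_minus_triangle (u v w : C) : Cmod (u - w) <= Cmod (u - v) + Cmod (v - w).
Proof.
replace (u - w)%C with ((u - v) + (v - w))%C by ring; apply Cmod_triangle.
Qed.

Lemma locally'_C_iff (z : C) (P : C -> Prop) :
  locally' (T := C_UniformSpace) z P <->
  exists d : R, 0 < d /\ forall w : C, w <> z -> Cmod (w - z) < d -> P w.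
Proof.
unfold locally', within; rewrite locally_C_iff.
split; intros [d [Hd H]]; exists d; split; auto.
Qed.

Section Continuation.

Variables (zeta Z K : C -> C).
Hypothesis Hzeta : meromorphic zeta.
Hypothesis HZ : forall z, 0 < Re z -> exists l, is_Cderive Z z l.
Hypothesis HK : forall z, 0 < Re z -> exists l, is_Cderive K z l.

Let D (z : C) : C := (zeta z * Z z - K z)%C.

(** A whole neighbourhood is required: this is what the identity theorem propagates, and the value
    of [D] at a single point says nothing at a pole, where that of zeta is arbitrary. *)
Let vanishes_near (q : C) : Prop :=
  exists eps, 0 < eps /\ forall z, Cmod (z - q) < eps -> D z = 0.

Lemma Re_pos_near (p z : C) : Cmod (z - p) < Re p -> 0 < Re z.
Proof.
intros H; pose proof (re_le_Cmod (z - p)) as B.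
rewrite re_minus in B; apply Rabs_le_between in B; lra.
Qed.

Lemma D_Cderivable (z : C) :
  0 < Re z -> C_differentiable zeta z -> exists l, is_Cderive D z l.
Proof.
intros Hz Hd; apply C_differentiable_iff in Hd.
destruct Hd as [l Hl]; destruct (HZ z Hz) as [m Hm]; destruct (HK z Hz) as [k Hk].
eexists; apply (is_Cderive_minus (fun z => zeta z * Z z)%C K); [|exact Hk].
apply is_Cderive_mult; [exact Hl | exact Hm].
Qed.

(* Along a disc on which D = 0 and that touches p, zeta = K / Z stays bounded,
   so p cannot be a pole. *)
Lemma touching_pole_absurd (p q : C) :
  0 < Re p -> Z p <> 0 -> q <> p ->
  filterlim (fun z => Cmod (zeta z)) (locally' (T := C_UniformSpace) p)
    (Rbar_locally p_infty) ->
  (forall z, Cmod (z - q) < Cmod (p - q) -> D z = 0) -> False.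
Proof.
intros Hp HZp Hqp Hlim HD.
destruct (HZ p Hp) as [l Hl]; apply is_Cderive_continuous in Hl.
destruct (HK p Hp) as [k Hk]; apply is_Cderive_continuous in Hk.
apply Cmod_gt_0 in HZp; set (z0 := Cmod (Z p)) in *.
destruct (proj1 (CC_continuous_iff Z p) Hl (z0 / 2)) as [d1 [Hd1 H1]]; [lra|].
destruct (proj1 (CC_continuous_iff K p) Hk 1) as [d2 [Hd2 H2]]; [lra|].
set (k0 := Cmod (K p) + 1).
assert (Hk0 : 0 < k0) by (unfold k0; pose proof (Cmod_ge_0 (K p)); lra).
assert (Hlim' : locally' (T := C_UniformSpace) p
  (fun z => k0 / (z0 / 2) < Cmod (zeta z))).
(* Near p, |Z| > z0/2 and |K| < k0, so zeta Z = K forces |zeta| below this threshold. *)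
{ apply (Hlim (fun x => k0 / (z0 / 2) < x)); exists (k0 / (z0 / 2)); auto. }
apply locally'_C_iff in Hlim'; destruct Hlim' as [d3 [Hd3 H3]].
assert (Hqp' : (q - p)%C <> 0) by (apply Cminus_eq_contra; exact Hqp).
apply Cmod_gt_0 in Hqp'; set (r := Cmod (q - p)) in *.
set (d := Rmin d1 (Rmin d2 d3)).
assert (Hd : 0 < d) by (repeat apply Rmin_pos; auto).
(* The point p + tau (q - p) lies strictly inside the disc about q because tau > 0, and within d of
   p because tau r <= d/2. *)
set (tau := Rmin (1 / 2) (d / 2 / r)).
assert (Htau : 0 < tau <= 1 / 2).
{ split; [|apply Rmin_l]; apply Rmin_pos; [lra|].
  repeat apply Rdiv_lt_0_compat; lra. }
assert (Htau' : tau * r <= d / 2).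
{ apply Rle_trans with (d / 2 / r * r).
  - apply Rmult_le_compat_r; [lra | apply Rmin_r].
  - right; field; lra. }
set (z := (p + tau * (q - p))%C).
assert (Hzp : Cmod (z - p) = tau * r).
{ unfold z; replace (p + tau * (q - p) - p)%C with (tau * (q - p))%C by ring.
  rewrite Cmod_mult, Cmod_R, Rabs_pos_eq by lra; reflexivity. }
assert (Hzq : Cmod (z - q) = (1 - tau) * r).
{ unfold z; replace (p + tau * (q - p) - q)%C with (- ((1 - tau)%R * (q - p)))%C
    by (rewrite RtoC_minus; ring).
  rewrite Cmod_opp, Cmod_mult, Cmod_R, Rabs_pos_eq by lra; reflexivity. }
assert (Hz0 : z <> p).
{ intros E; rewrite E in Hzp; replace (p - p)%C with (RtoC 0) in Hzp by ring.
  rewrite Cmod_0 in Hzp; nra. }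
pose proof (Rmin_l d1 (Rmin d2 d3)) as M1; fold d in M1.
pose proof (Rmin_r d1 (Rmin d2 d3)) as M2; fold d in M2.
pose proof (Rmin_l d2 d3); pose proof (Rmin_r d2 d3).
assert (HDz : D z = 0).
{ apply HD; rewrite Hzq, (Cmod_minus_sym p q); fold r; nra. }
specialize (H1 z ltac:(lra)); specialize (H2 z ltac:(lra)).
specialize (H3 z Hz0 ltac:(lra)).
assert (HzZ : (zeta z * Z z)%C = K z).
{ apply Ceq_minus, HDz. }
apply (f_equal Cmod) in HzZ; rewrite Cmod_mult in HzZ.
pose proof (Cmod_triangle_inv (Z z) (Z p)) as T1.
pose proof (Cmod_triangle_inv (K z) (K p)) as T2.
apply Rabs_le_between in T1; apply Rabs_le_between in T2.
fold z0 in T1.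
assert (H4 : k0 / (z0 / 2) * (z0 / 2) < Cmod (zeta z) * Cmod (Z z)).
{ assert (0 < k0 / (z0 / 2)) by (apply Rdiv_lt_0_compat; lra).
  apply Rmult_le_0_lt_compat; lra. }
unfold Rdiv at 1 in H4; rewrite Rmult_assoc, Rinv_l in H4 by lra.
unfold k0 in H4; lra.
Qed.

(** At a point of holomorphy this is the identity theorem on a disc about q. At a pole it holds
    vacuously: vanishing near some q would spread to a disc touching p. *)
Lemma vanishing_propagates (p : C) :
  0 < Re p -> Z p <> 0 ->
  exists rho, 0 < rho /\ forall q, Cmod (q - p) < rho -> vanishes_near q ->
    forall z, Cmod (z - p) < rho -> D z = 0.
Proof.
intros Hp HZp; destruct (Hzeta p) as [Hhol|[Hpunct Hlim]].
- apply locally_C_iff in Hhol; destruct Hhol as [d [Hd H]].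
  (* The disc of radius 2 rho about q contains the disc of radius rho about p and stays within 3 rho
     of p. *)
  set (rho := Rmin d (Re p) / 3).
  assert (Hm : 0 < Rmin d (Re p)) by (apply Rmin_pos; auto).
  pose proof (Rmin_l d (Re p)) as M1; pose proof (Rmin_r d (Re p)) as M2.
  exists rho; split; [unfold rho; lra|].
  intros q Hq [eps [Heps H0]] z Hz.
  apply (vanishes_on_disc D q (2 * rho) eps); auto.
  + intros w Hw; pose proof (Cmod_minus_triangle w q p).
    apply D_Cderivable; [apply (Re_pos_near p) | apply H]; unfold rho in *; lra.
  + pose proof (Cmod_minus_triangle z p q) as T1.
    rewrite (Cmod_minus_sym p q) in T1; lra.
- apply locally'_C_iff in Hpunct; destruct Hpunct as [d [Hd H]].
  set (rho := Rmin d (Re p) / 2).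
  assert (Hm : 0 < Rmin d (Re p)) by (apply Rmin_pos; auto).
  pose proof (Rmin_l d (Re p)) as M1; pose proof (Rmin_r d (Re p)) as M2.
  exists rho; split; [unfold rho; lra|]; intros q Hq H0; exfalso.
  assert (Habs : forall q, Cmod (q - p) < rho -> q <> p -> vanishes_near q -> False).
  { clear q Hq H0; intros q Hq Hqp [eps [Heps H0]].
    apply (touching_pole_absurd p q Hp HZp Hqp Hlim).
    apply (vanishes_on_disc D q (Cmod (p - q)) eps); auto.
    intros w Hw; pose proof (Cmod_minus_triangle w q p).
    rewrite (Cmod_minus_sym p q) in Hw.
    apply D_Cderivable; [apply (Re_pos_near p) | apply H];
      try (unfold rho in *; lra).
    intros E; rewrite E, (Cmod_minus_sym p q) in Hw; lra. }
  (* A touching disc needs a centre other than p; if q = p, it is moved to p + e inside the region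
     where [D] vanishes. *)
  destruct (Ceq_dec q p) as [->|Hqp]; [|apply (Habs q); auto].
  destruct H0 as [eps [Heps H0]].
  set (e := Rmin eps rho / 2).
  assert (He : 0 < Rmin eps rho) by (apply Rmin_pos; unfold rho; lra).
  pose proof (Rmin_l eps rho) as M3; pose proof (Rmin_r eps rho) as M4.
  assert (Hpe : Cmod (p + e - p) = e).
  { replace (p + e - p)%C with (RtoC e) by ring.
    rewrite Cmod_R, Rabs_pos_eq; unfold e; lra. }
  apply (Habs (p + e)%C).
  + rewrite Hpe; unfold e; lra.
  + intros E; rewrite E in Hpe; replace (p - p)%C with (RtoC 0) in Hpe by ring.
    rewrite Cmod_0 in Hpe; unfold e in Hpe; lra.
  + exists e; split; [unfold e; lra|]; intros z Hz; apply H0.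
    pose proof (Cmod_minus_triangle z (p + e) p); unfold e in *; lra.
Qed.

Lemma vanishing_along_segment (p v : C) :
  (forall t, 0 <= t <= 1 -> 0 < Re (p + t * v) /\ Z (p + t * v) <> 0) ->
  vanishes_near p -> D (p + v) = 0.
Proof.
intros Hpath H0.
assert (H1 : vanishes_near (p + 1%R * v)).
{ apply (unit_interval_induction (fun t => vanishes_near (p + t * v))).
  - replace (p + 0%R * v)%C with p by ring; exact H0.
  - intros t0 Ht0; destruct (Hpath t0 Ht0) as [Hp HZp].
    destruct (vanishing_propagates _ Hp HZp) as [rho [Hrho H]].
    assert (Hv := Cmod_ge_0 v).
    exists (rho / (Cmod v + 1)); split; [apply Rdiv_lt_0_compat; lra|].
    assert (Hclose : forall t, Rabs (t - t0) < rho / (Cmod v + 1) ->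
      Cmod (p + t * v - (p + t0 * v)) < rho).
    { intros t Ht.
      replace (p + t * v - (p + t0 * v))%C with ((t - t0)%R * v)%C
        by (rewrite RtoC_minus; ring).
      rewrite Cmod_mult, Cmod_R.
      apply (Rmult_lt_compat_r (Cmod v + 1)) in Ht; [|lra].
      unfold Rdiv in Ht; rewrite Rmult_assoc, Rinv_l in Ht by lra.
      pose proof (Rabs_pos (t - t0)); lra. }
    intros t _ Ht HSt u _ Hu; apply Hclose in Ht; apply Hclose in Hu.
    exists (rho - Cmod (p + u * v - (p + t0 * v))); split; [lra|].
    intros z Hz; apply (H _ Ht HSt).
    pose proof (Cmod_minus_triangle z (p + u * v) (p + t0 * v)); lra. }
replace (p + v)%C with (p + 1%R * v)%C by ring.
destruct H1 as [eps [Heps H1]]; apply H1.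
replace (p + 1%R * v - (p + 1%R * v))%C with (RtoC 0) by ring.
rewrite Cmod_0; exact Heps.
Qed.

End Continuation.

(** * The identity in the strip and the theorem *)

Lemma zeta_functional_identity (M : nat) (zeta : C -> C) (s : C) :
  is_hypergeometric_zeta (S M) zeta -> 0 < Re s < 1 ->
  (zeta s * ((s - 1) * Gamma (s + INR (S M) - 1)))%C =
  ((s - 1) * mellin (fun x => RtoC (phi M x)) s
   + INR (fact (S M)) * Gamma s)%C.
Proof.
intros [Hmer Hzeta] Hs.
set (Z := fun s : C => ((s - 1) * Gamma (s + INR (S M) - 1))%C).
set (K := fun s : C => ((s - 1) * mellin (fun x => RtoC (phi M x)) s
   + INR (fact (S M)) * Gamma s)%C).
assert (HRe : forall z, 0 < Re z -> 0 < Re (z + INR (S M) - 1)).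
{ intros z Hz; rewrite re_minus, re_plus, !re_RtoC, S_INR.
  pose proof (pos_INR M); lra. }
assert (Hlin : forall z, exists l, is_Cderive (fun z => z - 1)%C z l).
{ intros z; eexists.
  apply (is_Cderive_minus (fun z => z) (fun _ => RtoC 1));
    [apply is_Cderive_id | apply is_Cderive_const]. }
assert (HZ : forall z, 0 < Re z -> exists l, is_Cderive Z z l).
{ intros z Hz; destruct (Hlin z) as [k Hk].
  destruct (ex_Cderive_Gamma _ (HRe z Hz)) as [l Hl].
  eexists; apply (is_Cderive_mult (fun z => z - 1)%C
    (fun z => Gamma (z + INR (S M) - 1))); [exact Hk|].
  apply (is_Cderive_comp Gamma (fun z => z + INR (S M) - 1)%C); [exact Hl|].
  apply (is_Cderive_minus (fun z => z + INR (S M))%C (fun _ => RtoC 1));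
    [|apply is_Cderive_const].
  apply (is_Cderive_plus (fun z => z) (fun _ => RtoC (INR (S M))));
    [apply is_Cderive_id | apply is_Cderive_const]. }
assert (HK : forall z, 0 < Re z -> exists l, is_Cderive K z l).
{ intros z Hz; destruct (Hlin z) as [k Hk].
  destruct (ex_Cderive_Gamma z Hz) as [l Hl].
  destruct (ex_Cderive_mellin _ z (phi_rapidly_decreasing M) Hz) as [m Hm].
  eexists; apply (is_Cderive_plus
    (fun z => (z - 1) * mellin (fun x => RtoC (phi M x)) z)%C
    (fun z => INR (fact (S M)) * Gamma z)%C).
  - apply (is_Cderive_mult (fun z => z - 1)%C); [exact Hk | exact Hm].
  - apply (is_Cderive_mult (fun _ => RtoC (INR (fact (S M)))));
      [apply is_Cderive_const | exact Hl]. }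
assert (Hright : forall z, 1 < Re z -> (zeta z * Z z - K z)%C = 0).
{ intros z Hz; rewrite Hzeta by auto; unfold zeta_integral, Z, K.
  pose proof (Gamma_neq_0 _ (HRe z ltac:(lra))) as HG.
  assert (HI := is_integral_0_oo_unique _ _ (is_integral_zeta M z Hz)).
  replace (S M - 1)%nat with M by lia.
  rewrite HI.
  assert (HG1 : Gamma z = ((z - 1) * Gamma (z - 1))%C).
  { replace z with (z - 1 + 1)%C at 1 by ring; apply Gamma_plus_1.
    rewrite re_minus, re_RtoC; lra. }
  rewrite HG1; field; exact HG. }
apply Ceq_minus.
(* The segment starts at s - v = s + 2 + i sg, in Re > 1, and slopes away from the real axis on the
   side of s. Only its end s can be real, and there Re s < 1, so 1 is avoided even for real s. *)
set (sg := if Rle_dec 0 (Im s) then 1 else -1).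
set (v := (- 2, - sg) : C).
change (zeta s * Z s - K s = 0)%C.
replace s with (s - v + v)%C by ring.
apply (vanishing_along_segment zeta Z K Hmer HZ HK).
- intros t Ht.
  assert (HRet : Re (s - v + t * v) = Re s + 2 * (1 - t)).
  { unfold v, Re; simpl; ring. }
  assert (HImt : Im (s - v + t * v) = Im s + sg * (1 - t)).
  { unfold v, Im; simpl; ring. }
  assert (Hpos : 0 < Re (s - v + t * v)) by (rewrite HRet; lra).
  split; auto; unfold Z; apply Cmult_neq_0; [|apply Gamma_neq_0, HRe, Hpos].
  intros E; assert (E1 := f_equal Re E); assert (E2 := f_equal Im E).
  rewrite re_minus, HRet, !re_RtoC in E1.
  change (Im (s - v + t * v) - 0 = 0) in E2; rewrite HImt in E2.
  unfold sg in E2; destruct (Rle_dec 0 (Im s)); nra.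
(* The starting point has real part above 2, so the unit disc about it stays in Re > 1. *)
- exists 1; split; [lra|]; intros z Hz; apply Hright.
  pose proof (re_le_Cmod (z - (s - v))) as B; rewrite !re_minus in B.
  change (Re v) with (- 2) in B; apply Rabs_le_between in B; lra.
Qed.

Theorem theorem3p1 (N : nat) (hN : (1 <= N)%nat)
    (zeta : C -> C) (hzeta : is_hypergeometric_zeta N zeta)
    (s : C) (hs : 0 < Re s < 1) :
  let f := fun x : R =>
    (RtoC (1 / (exp x - T (N - 1) x) - INR (fact N) / x ^ N)%R
     * Rcpow x (s + INR N - 2))%C in
  converges_0_oo f /\
  zeta s = (/ Gamma (s + INR N - 1) * integral_0_oo f)%C.
Proof.
destruct N as [|M]; [lia|].
intros f.
assert (Hf := is_integral_zeta_strip M s hs).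
change (is_integral_0_oo (fun x => RtoC (1 / (exp x - T M x)
  - INR (fact (S M)) / x ^ S M) * Rcpow x (s + INR (S M) - 2))%C
  (mellin (fun x => RtoC (phi M x)) s
   + INR (fact (S M)) * (/ (s - 1) * Gamma s))) in Hf.
assert (Hf' : is_integral_0_oo f (mellin (fun x => RtoC (phi M x)) s
   + INR (fact (S M)) * (/ (s - 1) * Gamma s))).
{ unfold f; replace (S M - 1)%nat with M by lia; exact Hf. }
split; [eexists; exact Hf'|].
rewrite (is_integral_0_oo_unique _ _ Hf').
assert (Hs1 : (s - 1)%C <> 0).
{ intros E; apply (f_equal Re) in E; rewrite re_minus, !re_RtoC in E; lra. }
assert (HG : Gamma (s + INR (S M) - 1) <> 0).
{ apply Gamma_neq_0; rewrite re_minus, re_plus, !re_RtoC, S_INR.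
  pose proof (pos_INR M); lra. }
pose proof (zeta_functional_identity M zeta s hzeta hs) as H.
replace (zeta s) with (zeta s * ((s - 1) * Gamma (s + INR (S M) - 1))
  * / (s - 1) * / Gamma (s + INR (S M) - 1))%C by (field; auto).
rewrite H; field; auto.
Qed.
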